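(* Let $\mu$ be a nonzero finite Borel measure on the unit circle $\mathbb{T}$. (i) If $U$ is a unitary operator unitarily equivalent to the operator of multiplication by the independent variable on the scalar-valued space $L^2(\mu)$, then $U$ may be a twist of a trivial pair only, that is, of a pair whose product is $0$: every $U$-commuting pair $(S,T)$ satisfies $ST=0$. (ii) If $U$ is a unitary operator unitarily equivalent to the operator of multiplication by the independent variable on a vector-valued space $L^2(\mu,\mathcal{H})$, where $\mathcal{H}$ is a Hilbert space of dimension at least two (possibly infinite), then $U$ may be the twist of a nontrivial pair: there exists a $U$-commuting pair $(S,T)$ with $ST\neq 0$.
   Context: For a unitary $U$ on a Hilbert space $H$, a pair $(S,T)$ of bounded operators on $H$ is called $U$-commuting (twisted commuting with twist $U$) if $U$ commutes with both $S$ and $T$ and $ST=UTS$. $L^2(\mu,\mathcal{H})$ is the space of $\mathcal{H}$-valued Borel functions that are square integrable with respect to $\mu$, and $L^2(\mu)$ is the space of scalar-valued ones.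
   Formalization: Part (i) is proved under the added hypothesis μ({1}) = 0; without it (i) is false, since if μ({1}) > 0 the projection P onto functions supported at {1} gives the U-commuting pair (P,P) with product P ≠ 0. Part (ii) is proved as stated. *)

(* Defs.v *)
From HB Require Import structures.
From mathcomp Require Import all_boot all_order all_algebra.
From mathcomp Require Import all_classical all_reals all_analysis.
From mathcomp Require Import complex.
From mathcomp Require Import measurable_realfun ring lra.
Set Implicit Arguments.
Unset Strict Implicit.
Unset Printing Implicit Defensive.
Import Order.TTheory GRing.Theory Num.Theory.
Import numFieldNormedType.Exports.
Local Open Scope classical_set_scope.
Local Open Scope ring_scope.
Local Open Scope complex_scope.

(* The inner product is linear in its first argument. *)

HB.mixin Record hasInnerProduct (R : realType) V of GRing.Lmodule R[i] V := {
  inner : {dot V for Num.Def.conjC} }.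

#[short(type="innerProductType")]
HB.structure Definition InnerProduct (R : realType) :=
  {V of GRing.Lmodule R[i] V & hasInnerProduct R V}.

HB.mixin Record isHilbert (R : realType) V
    of InnerProduct R V & NormedModule R[i] V := {
  sqr_norm_inner : forall x : V, `|x| ^+ 2 = inner x x }.

#[short(type="hilbertType")]
HB.structure Definition Hilbert (R : realType) :=
  {V of InnerProduct R V & CompleteNormedModule R[i] V & isHilbert R V}.

Section ComplexNorm.
Variable R : realType.
Local Notation C := (R[i]^o).

Lemma ball_ReIm (x y : C) (e : R) : `|x - y| < e%:C ->
  `|complex.Re x - complex.Re y| < e /\ `|complex.Im x - complex.Im y| < e.
Proof.
case: x y => a b [c d] h.
have e0 : 0 <= e by rewrite -ler0c; exact: le_trans (normr_ge0 _) (ltW h).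
move: h; rewrite -(ltr_pXn2r (n := 2)) ?nnegrE ?normr_ge0 ?ler0c//.
rewrite -add_Re2_Im2 -rmorphXn/= ltcR => h.
have sq (u v : R) : u ^+ 2 + v ^+ 2 < e ^+ 2 -> `|u| < e.
  move=> uv; rewrite -(ltr_pXn2r (n := 2)) ?nnegrE//.
  rewrite real_normK ?num_real//; apply: le_lt_trans uv.
  by rewrite lerDl sqr_ge0.
split; first exact: sq h.
by apply: sq; rewrite addrC; exact: h.
Qed.

Lemma norm_le_ReIm (x : C) :
  `|x| <= (`|complex.Re x| + `|complex.Im x|)%:C.
Proof.
rewrite normc_def lecR -(ler_pXn2r (n := 2)) ?nnegrE ?sqrtr_ge0 ?addr_ge0//.
rewrite sqr_sqrtr ?addr_ge0 ?sqr_ge0// sqrrD !real_normK ?num_real//.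
by rewrite lerD2r lerDl mulrn_wge0// mulr_ge0.
Qed.

Lemma complex_complete (F : set_system C) :
  ProperFilter F -> cauchy F -> cvg F.
Proof.
move=> FF /cauchyP cF.
have cF' (e : R) : 0 < e -> exists x : C, \forall y \near F, `|x - y| < e%:C.
  move=> e0; have [|x Fx] := cF e%:C; first by rewrite ltcR.
  by exists x; move: Fx; rewrite -ball_normE.
have cRe : cauchy (@complex.Re R @ F : set_system R^o).
  apply: cauchy_exP => e /cF'[x Fx]; exists (complex.Re x).
  by apply: filterS Fx => y /ball_ReIm[] ? ?; rewrite -ball_normE.
have cIm : cauchy (@complex.Im R @ F : set_system R^o).
  apply: cauchy_exP => e /cF'[x Fx]; exists (complex.Im x).
  by apply: filterS Fx => y /ball_ReIm[] ? ?; rewrite -ball_normE.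
have [a /cvgrPdist_lt Fa] :
    exists a : R^o, (@complex.Re R @ F : set_system R^o) --> a.
  by apply/cvg_ex; apply: R_complete.
have [b /cvgrPdist_lt Fb] :
    exists b : R^o, (@complex.Im R @ F : set_system R^o) --> b.
  by apply/cvg_ex; apply: R_complete.
apply/cvg_ex; exists (a +i* b : C); apply/cvgrPdist_lt => e e0.
have er : e = (complex.Re e)%:C by rewrite RRe_real// gtr0_real.
have e20 : 0 < complex.Re e / 2 by rewrite divr_gt0// -ltcR -er.
near=> y; apply: le_lt_trans (norm_le_ReIm _) _.
rewrite er ltcR (splitr (complex.Re e)) raddfB/= raddfB/=; apply: ltrD.
- by near: y; apply: Fa.
- by near: y; apply: Fb.
Unshelve. all: by end_near. Qed.

End ComplexNorm.

(* The one-dimensional Hilbert space of scalars.  It is an alias of the regular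
   module R[i]^o because the library already attaches a complete space to every
   S^o with S a realType, which blocks a second one for S = R[i]. *)
Definition scalar_space (R : realType) : Type := R[i]^o.

HB.instance Definition _ (R : realType) :=
  NormedModule.copy (scalar_space R) (R[i]^o).

Section ScalarHilbert.
Variable R : realType.
Local Notation C := (scalar_space R).

HB.instance Definition _ := Uniform_isComplete.Build C (@complex_complete R).

Definition scalar_inner (x y : C) : R[i] := (x : R[i]) * Num.conj (y : R[i]).

Lemma scalar_inner_bilinear :
  bilinear_for *%R (Num.Def.conjC \; *%R) scalar_inner.
Proof.
split=> [u a x y|u a x y]; rewrite /scalar_inner /=.
  by rewrite /GRing.scale/= mulrDl mulrA.
by rewrite /GRing.scale/= rmorphD rmorphM mulrDr mulrCA.
Qed.

HB.instance Definition _ :=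
  bilinear_isBilinear.Build R[i] C C R[i] *%R (Num.Def.conjC \; *%R)
    scalar_inner scalar_inner_bilinear.

Lemma scalar_inner_hermitian (x y : C) :
  scalar_inner x y = (-1) ^+ false * Num.conj (scalar_inner y x).
Proof. by rewrite /scalar_inner expr0 mul1r rmorphM /= conjCK mulrC. Qed.

HB.instance Definition _ :=
  isHermitianSesquilinear.Build R[i] C false Num.Def.conjC scalar_inner
    scalar_inner_hermitian.

Lemma scalar_inner_gt0 (u : C) : u != 0 -> 0 < scalar_inner u u.
Proof.
by move=> u0; rewrite /scalar_inner -normCK exprn_gt0// (normr_gt0 (u : R[i]^o)).
Qed.

HB.instance Definition _ :=
  isDotProduct.Build R[i] C scalar_inner scalar_inner_gt0.

HB.instance Definition _ := hasInnerProduct.Build R C scalar_inner.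

Lemma scalar_norm_inner (x : C) : `|x| ^+ 2 = inner x x.
Proof. exact: normCK. Qed.

HB.instance Definition _ := isHilbert.Build R C scalar_norm_inner.

End ScalarHilbert.

Notation borel X := (g_sigma_algebraType (@open X)).

(* Borel with separable range.  The second condition is automatic when V is
   separable; in general it makes the measurable functions closed under sums. *)
Definition strongly_measurable d (T : measurableType d) (R : realType)
    (V : normedModType R[i]) (f : T -> V) :=
  measurable_fun setT (f : T -> borel V) /\
  exists2 D : set V, countable D & range f `<=` closure D.

Section StronglyMeasurable.
Context d (T : measurableType d) (R : realType).
Implicit Types V W : normedModType R[i].

Lemma gt0_complexE (e : R[i]) : 0 < e -> e = (complex.Re e)%:C.
Proof. by move=> e0; rewrite RRe_real// gtr0_real. Qed.

Lemma ex_natSinv_lt (e : R[i]) : 0 < e -> exists n : nat, n.+1%:R^-1 < e.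
Proof.
move=> e0; have e1 : 0 < complex.Re e by rewrite -ltcR -gt0_complexE.
have [n _ /(_ n (leqnn n)) nR] := near_infty_natSinv_lt (PosNum e1).
exists n; rewrite (gt0_complexE e0).
have -> : n.+1%:R^-1 = (n.+1%:R^-1 : R)%:C by rewrite fmorphV rmorph_nat.
by rewrite ltcR.
Qed.

Lemma strongly_measurable_seq V (f : T -> V) : strongly_measurable f ->
  exists u : nat -> V, forall t (e : R[i]), 0 < e -> exists n, `|u n - f t| < e.
Proof.
move=> [_ [D /countable_injP[h hinj] fD]].
exists (fun n => xget 0 [set x | D x /\ h x = n]) => t e e0.
have /fD/(_ (ball (f t) e)) : range f (f t) by exists t.
case; first exact: nbhsx_ballx.
move=> x [Dx]; rewrite -ball_normE /= distrC => xe; exists (h x).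
case: xgetP => [y _ [Dy hy]|/(_ x)[]//].
by rewrite (_ : y = x)//; apply: hinj => //; apply/mem_set.
Qed.

Lemma strongly_measurable_preimage2 V W (f : T -> V) (g : T -> W)
    (O : set (V * W)) :
  strongly_measurable f -> strongly_measurable g -> open O ->
  measurable [set t | O (f t, g t)].
Proof.
move=> mf mg Oo.
have [u uf] := strongly_measurable_seq mf.
have [v vg] := strongly_measurable_seq mg.
have mball (X : normedModType R[i]) (k : T -> X) x e :
    strongly_measurable k -> measurable (k @^-1` ball x e).
  move=> [mk _]; rewrite -[X in measurable X]setTI; apply: mk => //.
  apply: sub_sigma_algebra; exact: ball_open.
rewrite (_ : [set t | _] = \bigcup_n \bigcup_m \bigcup_k
    (if `[< ball (u n) k.+1%:R^-1 `*` ball (v m) k.+1%:R^-1 `<=` O >] then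
      f @^-1` ball (u n) k.+1%:R^-1 `&` g @^-1` ball (v m) k.+1%:R^-1
    else set0)).
  apply: bigcupT_measurable => n; apply: bigcupT_measurable => m.
  apply: bigcupT_measurable => k; case: ifPn => _ //.
  by apply: measurableI; exact: mball.
apply/seteqP; split => t /=.
  move=> Ot; have : nbhs (f t, g t) O by exact: open_nbhs_nbhs.
  move=> [[A B] /= [/nbhs_ballP[a /= a0 aA] /nbhs_ballP[b /= b0 bB]] ABO].
  pose c := Num.min (complex.Re a) (complex.Re b).
  have c0 : 0 < c%:C.
    by rewrite ltcR lt_min -!ltcR -!gt0_complexE// a0.
  have ca : c%:C <= a by rewrite (gt0_complexE a0) lecR ge_min lexx.
  have cb : c%:C <= b by rewrite (gt0_complexE b0) lecR ge_min lexx orbT.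
  have [k kc] := ex_natSinv_lt (divr_gt0 c0 (ltr0n _ 2)).
  have k0 : 0 < k.+1%:R^-1 :> R[i] by rewrite invr_gt0.
  have [n un] := uf t _ k0; have [m vm] := vg t _ k0.
  exists n => //; exists m => //; exists k => //; case: ifPn => [_|/asboolP[]].
    by split; rewrite /= -ball_normE.
  move=> [y z] [/= uy vz]; apply: ABO; split => /=.
    apply/aA/(le_ball ca)/(@ball_splitr _ _ (u n)).
      by apply: le_ball (ltW kc) _ _; rewrite -ball_normE.
    by apply: le_ball (ltW kc) _ _.
  apply/bB/(le_ball cb)/(@ball_splitr _ _ (v m)).
    by apply: le_ball (ltW kc) _ _; rewrite -ball_normE.
  by apply: le_ball (ltW kc) _ _.
by move=> [n _ [m _ [k _]]]; case: ifPn => [/asboolP h [? ?]|//]; apply: h.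
Qed.

Lemma strongly_measurable_comp2 V W (X : normedModType R[i]) (h : V * W -> X)
    (f : T -> V) (g : T -> W) :
  continuous h -> strongly_measurable f -> strongly_measurable g ->
  strongly_measurable (fun t => h (f t, g t)).
Proof.
move=> hC mf mg; have /continuousP hc := hC; split.
  apply: (@measurability _ _ T (borel X) setT _ (@open X)) => //.
  move=> _ [B oB <-]; rewrite setTI.
  exact: (strongly_measurable_preimage2 mf mg (hc _ oB)).
have [_ [D cD fD]] := mf.
have [_ [E cE gE]] := mg.
exists (h @` (D `*` E)).
  exact: sub_countable (card_image_le _ _) (countableX cD cE).
move=> _ [t _ <-] B /= /hC[[P Q] /= [fP gQ] PQB].
have [v [Dv Pv]] : D `&` P !=set0 by apply: fD fP; exists t.
have [w [Ew Qw]] : E `&` Q !=set0 by apply: gE gQ; exists t.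
by exists (h (v, w)); split; [exists (v, w)|exact: (PQB (v, w))].
Qed.

Lemma strongly_measurable_cst V (v : V) :
  strongly_measurable (fun _ : T => v).
Proof.
split; first exact: measurable_cst.
by exists [set v] => //; move=> _ [t _ <-]; apply: subset_closure.
Qed.

Lemma strongly_measurableD V (f g : T -> V) :
  strongly_measurable f -> strongly_measurable g ->
  strongly_measurable (fun t => f t + g t).
Proof.
by apply: (strongly_measurable_comp2 (h := fun z => z.1 + z.2)); exact: add_continuous.
Qed.

Lemma strongly_measurableZ V (a : T -> R[i]^o) (f : T -> V) :
  strongly_measurable a -> strongly_measurable f ->
  strongly_measurable (fun t => a t *: f t).
Proof.
exact: (@strongly_measurable_comp2 R[i]^o V V (fun z => z.1 *: z.2) a f
  (@scale_continuous _ V)).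
Qed.

Lemma measurable_norm2 V (f : T -> V) : strongly_measurable f ->
  measurable_fun setT (fun t => complex.Re `|f t| ^+ 2).
Proof.
move=> mf; apply: measurable_funX.
apply: (measurability _ (RGenOInfty.measurableE R)) => /= _ [_ [a ->] <-].
rewrite setTI preimage_itvoy.
apply: (strongly_measurable_preimage2
  (O := [set z : V * V | a < complex.Re `|z.1|]) mf mf).
rewrite (_ : [set _ | _] = fst @^-1` [set v | a < complex.Re `|v|])//.
apply: open_comp => [? _|]; first exact: cvg_fst.
rewrite openE => v /= av; apply/nbhs_ballP; exists (complex.Re `|v| - a)%:C.
  by rewrite /= ltcR subr_gt0.
move=> w; rewrite -ball_normE /= => vw.
have : `|v| <= `|w| + `|v - w| by rewrite addrC -lerBlDr lerB_dist.
have Cre (x : V) : `|x| = (complex.Re `|x|)%:C by rewrite RRe_real.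
move: vw; rewrite (Cre (v - w)) (Cre v) (Cre w) -rmorphD/= lecR ltcR /=.
by move=> vw vwv; lra.
Qed.

End StronglyMeasurable.

Section HilbertFacts.
Context (R : realType) (H : hilbertType R).
Implicit Types u v w : H.

Definition sqn (v : H) : R := complex.Re `|v| ^+ 2.

Lemma norm_Re v : `|v| = (complex.Re `|v|)%:C.
Proof. by rewrite RRe_real. Qed.

Lemma Re_norm_ge0 v : 0 <= complex.Re `|v|.
Proof. by rewrite -ler0c -norm_Re. Qed.

Lemma sqn_inner v : inner v v = (sqn v)%:C.
Proof. by rewrite -sqr_norm_inner norm_Re -rmorphXn. Qed.

Lemma sqn_ge0 v : 0 <= sqn v. Proof. exact: sqr_ge0. Qed.

Lemma sqn_eq0 v : (sqn v == 0) = (v == 0).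
Proof.
by rewrite /sqn sqrf_eq0 -[RHS]normr_eq0 norm_Re -(inj_eq (@complexI R)).
Qed.

Lemma sqnZ a v : sqn (a *: v) = complex.Re `|a| ^+ 2 * sqn v.
Proof.
have aE : `|a| = (complex.Re `|a|)%:C by rewrite RRe_real.
by rewrite /sqn normrZ aE norm_Re -rmorphM/= exprMn.
Qed.

Lemma sqnD_le u v : sqn (u + v) <= 2 * sqn u + 2 * sqn v.
Proof.
have : complex.Re `|u + v| <= complex.Re `|u| + complex.Re `|v|.
  by rewrite -lecR rmorphD/= -!norm_Re ler_normD.
have := Re_norm_ge0 (u + v); have := Re_norm_ge0 u; have := Re_norm_ge0 v.
rewrite /sqn; set a := complex.Re `|u|; set b := complex.Re `|v|.
set c := complex.Re `|u + v| => b0 a0 c0 cab.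
have h : c ^+ 2 <= (a + b) ^+ 2 by rewrite ler_pXn2r// nnegrE addr_ge0.
apply: le_trans h _; rewrite -subr_ge0.
by rewrite (_ : _ - _ = (a - b) ^+ 2) ?sqr_ge0//; ring.
Qed.

Lemma inner_sym u v : inner u v = Num.conj (inner v u).
Proof. by rewrite hermitian_subproof expr0 mul1r. Qed.

Lemma Re_inner u v :
  complex.Re (inner u v) = 4^-1 * (sqn (u + v) - sqn (u - v)).
Proof.
have -> : sqn (u + v) - sqn (u - v) =
    complex.Re (inner (u + v) (u + v) - inner (u - v) (u - v)).
  by rewrite !sqn_inner -rmorphB.
rewrite !linearDl !linearDr !linearNl !linearNr /= (inner_sym v u).
case: (inner u v) (inner u u) (inner v v) => a b [c d] [e f] /=. lra.
Qed.

Lemma Im_inner u v :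
  complex.Im (inner u v) = complex.Re (inner u ('i%C *: v)).
Proof.
by rewrite linearZr_LR /=; case: (inner u v) => a b /=; lra.
Qed.

End HilbertFacts.

Section L2.
Context d (T : measurableType d) (R : realType).
Variables (mu : {measure set T -> \bar R}) (H : hilbertType R).

Definition L2 : {pred T -> H} := mem [set f : T -> H |
  strongly_measurable f /\
  (\int[mu]_t (complex.Re `|f t| ^+ 2)%:E < +oo)%E].

Lemma L2P f : f \in L2 <-> strongly_measurable f /\
  mu.-integrable setT (EFin \o (fun t => sqn (f t))).
Proof.
split.
  rewrite inE => -[mf fi]; split => //; apply/integrableP; split.
    by apply/measurable_EFinP; exact: measurable_norm2.
  rewrite (eq_integral (fun t => (sqn (f t))%:E))// => t _ /=.
  by rewrite ger0_norm// sqn_ge0.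
move=> [mf /integrableP[_ fi]]; rewrite inE; split => //.
rewrite (eq_integral (fun t => `|(EFin \o (fun t => sqn (f t))) t|)%E)// => t _ /=.
by rewrite ger0_norm// sqn_ge0.
Qed.

Lemma L2_bounded f (g : T -> R) : strongly_measurable f ->
  mu.-integrable setT (EFin \o g) -> (forall t, sqn (f t) <= g t) -> f \in L2.
Proof.
move=> mf ig fg; apply/L2P; split => //; apply: le_integrable ig => //.
  by apply/measurable_EFinP; exact: measurable_norm2.
move=> t _ /=; rewrite lee_fin !ger0_norm ?sqn_ge0//.
by apply: le_trans (fg t); exact: sqn_ge0.
Qed.

Lemma L2_submod_closed : submod_closed L2.
Proof.
split.
  apply: (@L2_bounded _ (fun=> 0)) => [||t].
  - exact: strongly_measurable_cst.
  - exact: integrable0.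
  - by rewrite /sqn normr0 expr0n.
move=> a f g /L2P[mf fi] /L2P[mg gi].
apply: (@L2_bounded _
  (fun t => 2 * complex.Re `|a| ^+ 2 * sqn (f t) + 2 * sqn (g t))) => [||t].
- apply: strongly_measurableD => //.
  exact: (@strongly_measurableZ _ _ _ _ (fun=> a)) (strongly_measurable_cst _ _) mf.
- rewrite (_ : _ \o _ = (fun t => (2 * complex.Re `|a| ^+ 2)%:E *
      (EFin \o (fun t => sqn (f t))) t + 2%:E * (EFin \o (fun t => sqn (g t))) t)%E).
    by apply: integrableD => //; apply: integrableZl.
  by [].
- by apply: le_trans (sqnD_le _ _) _; rewrite sqnZ mulrA.
Qed.

HB.instance Definition _ := GRing.isSubmodClosed.Build _ _ L2 L2_submod_closed.

(* Square integrable functions, before identification almost everywhere. *)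
Record L2fun := MkL2fun { L2val :> T -> H; L2valP : L2val \in L2 }.
HB.instance Definition _ := [isSub for L2val].
HB.instance Definition _ := [Choice of L2fun by <:].
HB.instance Definition _ := [SubChoice_isSubLmodule of L2fun by <:].

Definition L2null : {pred L2fun} :=
  mem [set f : L2fun | {ae mu, forall t, f t = 0}].

Lemma L2null_submod_closed : submod_closed L2null.
Proof.
split; first by rewrite inE; apply: aeW.
move=> a f g; rewrite !inE; apply: filterS2 => t /= f0 g0.
by rewrite -[LHS]/(a *: f t + g t) f0 g0 scaler0 addr0.
Qed.

HB.instance Definition _ :=
  GRing.isSubmodClosed.Build _ _ L2null L2null_submod_closed.

(* L^2(mu, H): square integrable functions modulo almost everywhere equality. *)
Definition L2space : Type := Quotient.quot L2null.
HB.instance Definition _ := GRing.Zmodule.on L2space.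

Local Open Scope quotient_scope.

Definition L2class (f : L2fun) : L2space := \pi_(Quotient.quot L2null) f.
Definition L2repr (x : L2space) : L2fun := repr (x : Quotient.quot L2null).

Lemma L2reprK : cancel L2repr L2class. Proof. exact: reprK. Qed.

Lemma L2classP f g : L2class f = L2class g <-> {ae mu, forall t, f t = g t}.
Proof.
have -> : (L2class f = L2class g) <-> (f - g \in L2null).
  by rewrite Quotient.idealrBE; split=> [/eqP//|/eqP].
rewrite inE; split; apply: filterS => t fg.
  by apply/eqP; rewrite -subr_eq0; apply/eqP.
by rewrite -[LHS]/(f t - g t) fg subrr.
Qed.

Lemma L2classD : {morph L2class : f g / f + g}.
Proof. by move=> f g; rewrite /L2class !piE. Qed.

Definition L2scale (a : R[i]) (x : L2space) : L2space :=
  L2class (a *: L2repr x).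

Lemma L2classZ a f : L2class (a *: f) = L2scale a (L2class f).
Proof.
apply/L2classP; have /L2classP := L2reprK (L2class f).
apply: filterS => t fg.
by rewrite -[LHS]/(a *: f t) -fg.
Qed.

Lemma L2scaleA a b x : L2scale a (L2scale b x) = L2scale (a * b) x.
Proof. by rewrite -(L2reprK x) -!L2classZ scalerA. Qed.

Lemma L2scale1 : left_id 1 L2scale.
Proof. by move=> x; rewrite -(L2reprK x) -!L2classZ scale1r. Qed.

Lemma L2scaleDr : right_distributive L2scale +%R.
Proof.
move=> a x y; rewrite -(L2reprK x) -(L2reprK y) -L2classD -!L2classZ.
by rewrite scalerDr L2classD.
Qed.

Lemma L2scaleDl x : {morph L2scale^~ x : a b / a + b}.
Proof.
by move=> a b; rewrite -(L2reprK x) -!L2classZ scalerDl L2classD.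
Qed.

HB.instance Definition _ := GRing.Zmodule_isLmodule.Build R[i] L2space
  L2scaleA L2scale1 L2scaleDr L2scaleDl.

End L2.

Arguments L2 {d T R} mu H.
Arguments L2fun {d T R} mu H.
Arguments L2space {d T R} mu H.

Section L2Inner.
Context d (T : measurableType d) (R : realType).
Variables (mu : {measure set T -> \bar R}) (H : hilbertType R).
Implicit Types f g h : L2fun mu H.

Definition L2fun_inner (f g : T -> H) : R[i] :=
  (\int[mu]_t complex.Re (inner (f t) (g t))) +i*
  (\int[mu]_t complex.Im (inner (f t) (g t))).

Lemma L2fun_sqn f : mu.-integrable setT (EFin \o (fun t => sqn (f t))).
Proof. by have /L2P[] := L2valP f. Qed.

Lemma L2fun_Re f g :
  mu.-integrable setT (EFin \o (fun t => complex.Re (inner (f t) (g t)))).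
Proof.
rewrite (_ : _ \o _ = (fun t => 4^-1%:E *
    ((EFin \o (fun t => sqn ((f + g : L2fun mu H)%R t))) t -
     (EFin \o (fun t => sqn ((f - g : L2fun mu H)%R t))) t))%E).
  apply: integrableZl => //; apply: integrableB => //; exact: L2fun_sqn.
by apply/funext => t /=; rewrite Re_inner.
Qed.

Lemma L2fun_Im f g :
  mu.-integrable setT (EFin \o (fun t => complex.Im (inner (f t) (g t)))).
Proof.
rewrite (_ : _ \o _ = (EFin \o (fun t => complex.Re
  (inner (f t) (('i%C *: g : L2fun mu H) t))))); first exact: L2fun_Re.
by apply/funext => t /=; rewrite Im_inner.
Qed.

Lemma L2fun_inner_ae f f' g g' :
  {ae mu, forall t, f t = f' t} -> {ae mu, forall t, g t = g' t} ->
  L2fun_inner f g = L2fun_inner f' g'.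
Proof.
move=> ff' gg'; congr Complex; rewrite /Rintegral; congr fine.
  apply: ae_eq_integral => //; [exact: measurable_int (L2fun_Re f g)|
    exact: measurable_int (L2fun_Re f' g')|].
  by apply: filterS2 ff' gg' => t /= -> ->.
apply: ae_eq_integral => //; [exact: measurable_int (L2fun_Im f g)|
  exact: measurable_int (L2fun_Im f' g')|].
by apply: filterS2 ff' gg' => t /= -> ->.
Qed.

Lemma Rintegral_lin3 (x y : R) (A B P : T -> R) :
  mu.-integrable setT (EFin \o A) -> mu.-integrable setT (EFin \o B) ->
  mu.-integrable setT (EFin \o P) ->
  \int[mu]_t (x * A t + y * B t + P t) =
  x * \int[mu]_t A t + y * \int[mu]_t B t + \int[mu]_t P t.
Proof.
move=> iA iB iP.
have iZ (c : R) (K : T -> R) : mu.-integrable setT (EFin \o K) ->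
    mu.-integrable setT (EFin \o (fun t => c * K t)).
  move=> iK; rewrite (_ : _ \o _ = (fun t => c%:E * (EFin \o K) t)%E)//.
  exact: integrableZl.
rewrite RintegralD//; last first.
  rewrite (_ : _ \o _ = (fun t => (EFin \o (fun t => x * A t)%R) t +
    (EFin \o (fun t => y * B t)%R) t)%E)//.
  by apply: integrableD => //; exact: iZ.
by rewrite RintegralD ?RintegralZl//; exact: iZ.
Qed.

Lemma L2fun_innerPl a f g h :
  L2fun_inner (a *: f + g : L2fun mu H) h =
  a * L2fun_inner f h + L2fun_inner g h.
Proof.
have E t : inner ((a *: f + g : L2fun mu H) t) (h t) =
    a * inner (f t) (h t) + inner (g t) (h t).
  by rewrite -[(_ + _ : L2fun mu H) t]/(a *: f t + g t) linearDl linearZl_LR.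
rewrite /L2fun_inner.
have -> : \int[mu]_t complex.Re (inner ((a *: f + g : L2fun mu H) t) (h t)) =
    complex.Re a * \int[mu]_t complex.Re (inner (f t) (h t)) +
    (- complex.Im a) * \int[mu]_t complex.Im (inner (f t) (h t)) +
    \int[mu]_t complex.Re (inner (g t) (h t)).
  rewrite -Rintegral_lin3; [|exact: L2fun_Re|exact: L2fun_Im|exact: L2fun_Re].
  apply: eq_Rintegral => t _; rewrite E.
  by case: a {E} (inner _ _) (inner _ _) => x y [A B] [P Q] /=; rewrite mulNr.
have -> : \int[mu]_t complex.Im (inner ((a *: f + g : L2fun mu H) t) (h t)) =
    complex.Re a * \int[mu]_t complex.Im (inner (f t) (h t)) +
    complex.Im a * \int[mu]_t complex.Re (inner (f t) (h t)) +
    \int[mu]_t complex.Im (inner (g t) (h t)).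
  rewrite -Rintegral_lin3; [|exact: L2fun_Im|exact: L2fun_Re|exact: L2fun_Im].
  apply: eq_Rintegral => t _; rewrite E.
  by case: a {E} (inner _ _) (inner _ _) => x y [A B] [P Q].
by case: a {E} => x y; rewrite /= mulNr.
Qed.

Lemma L2fun_inner_sym f g : L2fun_inner f g = Num.conj (L2fun_inner g f).
Proof.
rewrite /L2fun_inner -[Num.conj _]/(conjc _) /=; congr Complex.
  by apply: eq_Rintegral => t _; rewrite inner_sym; case: (inner _ _).
rewrite -mulN1r -RintegralZl//; last exact: L2fun_Im.
by apply: eq_Rintegral => t _; rewrite inner_sym mulN1r; case: (inner _ _).
Qed.

Lemma L2fun_inner_gt0 f : ~ {ae mu, forall t, f t = 0} -> 0 < L2fun_inner f f.
Proof.
move=> f0; rewrite /L2fun_inner.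
have -> : \int[mu]_t complex.Im (inner (f t) (f t)) = 0.
  rewrite (@eq_Rintegral _ _ _ mu setT (cst 0)) => [|t _]; last by rewrite sqn_inner.
  by rewrite Rintegral_cst// mul0r.
have -> : \int[mu]_t complex.Re (inner (f t) (f t)) = \int[mu]_t sqn (f t).
  by apply: eq_Rintegral => t _; rewrite sqn_inner.
rewrite -[0]/(0 +i* 0) ltcE /= eqxx /= lt0r Rintegral_ge0 ?andbT; last first.
  by move=> t _; exact: sqn_ge0.
apply/eqP => i0; apply: f0.
have fi := L2fun_sqn f.
have /(ae_eq_integral_abs mu measurableT (measurable_int _ fi)) :
    (\int[mu]_t `|(EFin \o (fun t => sqn (f t))) t| = 0)%E.
  rewrite -[RHS]/(0%R%:E) -i0 /Rintegral fineK; last exact: integrable_fin_num.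
  by apply: eq_integral => t _ /=; rewrite ger0_norm// sqn_ge0.
apply: filterS => t /= /(_ I)[] /eqP; rewrite sqn_eq0 => /eqP//.
Qed.

Definition L2inner (x y : L2space mu H) : R[i] :=
  L2fun_inner (L2repr x) (L2repr y).

Lemma L2innerE f g : L2inner (L2class f) (L2class g) = L2fun_inner f g.
Proof. by apply: L2fun_inner_ae; apply/L2classP; rewrite L2reprK. Qed.

Lemma L2inner_sym x y :
  L2inner x y = (-1) ^+ false * Num.conj (L2inner y x).
Proof. by rewrite expr0 mul1r /L2inner L2fun_inner_sym. Qed.

Lemma L2innerPl a x y z :
  L2inner (a *: x + y) z = a * L2inner x z + L2inner y z.
Proof.
rewrite -(L2reprK x) -(L2reprK y) -(L2reprK z).
rewrite -[_ *: _]/(L2scale _ _) -L2classZ -L2classD !L2innerE.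
exact: L2fun_innerPl.
Qed.

Lemma L2inner_bilinear : bilinear_for *%R (Num.Def.conjC \; *%R) L2inner.
Proof.
split=> [z a x y|z a x y]; first exact: L2innerPl.
rewrite L2inner_sym L2innerPl expr0 mul1r rmorphD rmorphM/=.
by rewrite (L2inner_sym z x) (L2inner_sym z y) expr0 !mul1r.
Qed.

HB.instance Definition _ :=
  bilinear_isBilinear.Build R[i] (L2space mu H) (L2space mu H) R[i]
    *%R (Num.Def.conjC \; *%R) L2inner L2inner_bilinear.

HB.instance Definition _ :=
  isHermitianSesquilinear.Build R[i] (L2space mu H) false Num.Def.conjC
    L2inner L2inner_sym.

Lemma L2inner_gt0 x : x != 0 -> 0 < L2inner x x.
Proof.
move=> x0; apply: L2fun_inner_gt0 => h; case/eqP: x0.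
rewrite -(L2reprK x) (_ : 0 = L2class 0); first exact/L2classP.
by rewrite /L2class pi_zeror.
Qed.

HB.instance Definition _ :=
  isDotProduct.Build R[i] (L2space mu H) L2inner L2inner_gt0.

HB.instance Definition _ := hasInnerProduct.Build R (L2space mu H) L2inner.

End L2Inner.

(* The unit circle, with the topology and Borel sets induced from R[i]. *)
Definition circle (R : realType) : Type := set_type [set z : R[i]^o | `|z| = 1].

HB.instance Definition _ (R : realType) := Topological.on (circle R).

Lemma circle_point_subproof (R : realType) :
  (1 : R[i]^o) \in [set z : R[i]^o | `|z| = 1].
Proof. by rewrite inE/= normr1. Qed.

Definition circle1 (R : realType) : circle R :=
  exist _ (1 : R[i]^o) (circle_point_subproof R).

HB.instance Definition _ (R : realType) := isPointed.Build (circle R) (circle1 R).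

Definition circle_val (R : realType) (z : circle R) : R[i]^o := set_val z.

Section Multiplication.
Context (R : realType).

Lemma circle_val_norm (z : circle R) : `|circle_val z| = 1.
Proof. by have := set_valP z. Qed.

Lemma ex_rat_near (x e : R) : 0 < e -> exists q : rat, `|x - ratr q| < e.
Proof.
move=> e0; have /rat_in_itvoo[q] : x - e < x + e by lra.
by rewrite in_itv/= -ltr_distlC => qe; exists q.
Qed.

Lemma circle_val_measurable :
  strongly_measurable (circle_val (R := R) : borel (circle R) -> R[i]^o).
Proof.
split.
  apply: (@measurability _ _ (borel (circle R)) (borel R[i]^o) setT _
    (@open R[i]^o)) => // _ [B oB <-]; rewrite setTI.
  apply: sub_sigma_algebra.
  have /continuousP : continuous (circle_val (R := R)).
    exact: (@initial_continuous _ _ set_val).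
  exact.
exists (range (fun q : rat * rat => ratr q.1 +i* ratr q.2 : R[i]^o)).
  exact: sub_countable (card_image_le _ _) (countableP _).
move=> z _ B /nbhs_ballP[e /= e0 eB].
have e20 : 0 < complex.Re e / 2 by rewrite divr_gt0// -ltcR -gt0_complexE.
have [p pz] := ex_rat_near (complex.Re z) e20.
have [q qz] := ex_rat_near (complex.Im z) e20.
exists (ratr p +i* ratr q : R[i]^o); split; first by exists (p, q).
apply: eB; rewrite -ball_normE /=; apply: le_lt_trans (norm_le_ReIm _) _.
rewrite (gt0_complexE e0) ltcR (splitr (complex.Re e)).
by case: z pz qz => a b /= pz qz; apply: ltrD.
Qed.

Variables (mu : {measure set (borel (circle R)) -> \bar R}) (H : hilbertType R).

Lemma mulz_subproof (f : L2fun mu H) : (fun z => circle_val z *: f z) \in L2 mu H.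
Proof.
have /L2P[mf fi] := L2valP f; apply: (L2_bounded _ fi) => [|z].
  exact: strongly_measurableZ circle_val_measurable mf.
by rewrite sqnZ circle_val_norm expr1n mul1r.
Qed.

Definition mulz_fun (f : L2fun mu H) : L2fun mu H := MkL2fun (mulz_subproof f).

(* Multiplication by the independent variable. *)
Definition mulz (x : L2space mu H) : L2space mu H :=
  L2class (mulz_fun (L2repr x)).

Lemma mulzE f : mulz (L2class f) = L2class (mulz_fun f).
Proof.
apply/L2classP; have /L2classP := L2reprK (L2class f).
by apply: filterS => z /= ->.
Qed.

Lemma mulz_linear : linear mulz.
Proof.
move=> a x y; rewrite -(L2reprK x) -(L2reprK y).
rewrite -![_ *: _]/(L2scale _ _) -L2classZ -L2classD !mulzE -L2classZ -L2classD.
apply/L2classP/aeW => z.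
rewrite -[LHS]/(circle_val z *: (a *: L2repr x z + L2repr y z)).
rewrite -[RHS]/(a *: (circle_val z *: L2repr x z) + circle_val z *: L2repr y z).
by rewrite scalerDr !scalerA mulrC.
Qed.

HB.instance Definition _ :=
  GRing.isLinear.Build R[i] (L2space mu H) (L2space mu H) *:%R mulz mulz_linear.

End Multiplication.

Arguments mulz {R} mu H x.

Section Operators.
Context (R : realType).

Definition unitary (K L : innerProductType R) (W : {linear K -> L}) : Prop :=
  (forall x y, inner (W x) (W y) = inner x y) /\ (forall y, exists x, W x = y).

Definition unitarily_equivalent (K L : innerProductType R)
    (A : {linear K -> K}) (B : {linear L -> L}) : Prop :=
  exists2 W : {linear K -> L}, unitary W & forall x, W (A x) = B (W x).

Definition bounded_operator (K : hilbertType R) (A : {linear K -> K}) : Prop :=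
  exists M : R, forall x, `|A x| <= M%:C * `|x|.

Record twisted_commuting (K : hilbertType R) (U S T : {linear K -> K}) : Prop :=
  TwistedCommuting {
    twisted_boundedl : bounded_operator S;
    twisted_boundedr : bounded_operator T;
    twisted_comml : forall x, U (S x) = S (U x);
    twisted_commr : forall x, U (T x) = T (U x);
    twisted_comm : forall x, S (T x) = U (T (S x))
  }.

Definition dim_ge2 (H : hilbertType R) : Prop :=
  exists u v : H, forall a b : R[i], a *: u + b *: v = 0 -> a = 0 /\ b = 0.

End Operators.

(* Main.v *)
Require Import Defs.
From HB Require Import structures.
From mathcomp Require Import all_boot all_order all_algebra.
From mathcomp Require Import all_classical all_reals all_analysis.
From mathcomp Require Import complex.
From mathcomp Require Import measurable_realfun ring lra.
Set Implicit Arguments.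
Unset Strict Implicit.
Unset Printing Implicit Defensive.
Import Order.TTheory GRing.Theory Num.Theory.
Import numFieldNormedType.Exports.
Local Open Scope classical_set_scope.
Local Open Scope ring_scope.
Local Open Scope complex_scope.

(** Both parts reduce, by transport along the unitary equivalence, to the
    operator M of multiplication by z on L^2(mu, H).

    (i) The point is that for scalar functions the commutant of M is abelian.
    Given this, ST = UTS = U ST, so every vector ST x is fixed by M; it is then
    supported on the set z = 1, which has measure 0 (mulz_fixed).

    The commutant is abelian because a bounded S that commutes with M is the
    multiplication by S 1. To see this, consider all bounded real functions phi
    for which S commutes with the multiplication by phi. They form an algebra
    stable under bounded pointwise limits. It contains Re z and Im z, because
    2 z Re z = z^2 + 1 and 2 i z Im z = z^2 - 1 are polynomials in z and M is
    injective (commuting_quadratic). It contains with phi the indicators of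
    the sets phi > c, obtained as limits of polynomials in phi (commuting_gt).
    Hence the sets whose indicators belong to it form a sigma-algebra that
    contains all open sets (commuting_borel), and so it contains every bounded
    Borel function (commuting_multiplier). Applying this to truncations of an
    arbitrary f gives S f = f S 1 (commuting_is_multiplication), and two
    multiplications commute.

    (ii) A field of 2 x 2 matrices acts on the part of L^2(mu, H) with values in
    a plane of H and commutes with M. The elementary matrix S = E_12 and the
    diagonal matrix T = diag(1, z) satisfy ST = z E_12 and TS = E_12, hence
    ST = z TS, and ST is not 0 (nontrivial_twist_model). *)

(** * Squared norms and unitary equivalence *)

Section SquaredNorm.
Context (R : realType).

(** The spaces L^2(mu, H) carry an inner product but no norm structure, so
    boundedness of operators is expressed through the squared norm. *)
Definition nsq (V : innerProductType R) (x : V) : R := complex.Re (inner x x).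

Lemma nsq_gt0 (V : innerProductType R) (x : V) : x != 0 -> 0 < nsq x.
Proof.
by rewrite -(dnorm_gt0 (@inner R V)) ltcE => /andP[].
Qed.

Lemma nsq0 (V : innerProductType R) : nsq (0 : V) = 0.
Proof. by rewrite /nsq linear0l. Qed.

Lemma nsq_ge0 (V : innerProductType R) (x : V) : 0 <= nsq x.
Proof. by have [->|/nsq_gt0/ltW//] := eqVneq x 0; rewrite nsq0. Qed.

Lemma nsq_eq0 (V : innerProductType R) (x : V) : nsq x = 0 -> x = 0.
Proof. by apply: contra_eq => /nsq_gt0; rewrite lt0r => /andP[]. Qed.

Lemma nsqN (V : innerProductType R) (x : V) : nsq (- x) = nsq x.
Proof. by rewrite /nsq linearNl linearNr /= opprK. Qed.

(** By the parallelogram law the difference of the two sides is nsq (x - y). *)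
Lemma nsqD_le (V : innerProductType R) (x y : V) :
  nsq (x + y) <= 2 * nsq x + 2 * nsq y.
Proof.
rewrite -subr_ge0; suff -> : 2 * nsq x + 2 * nsq y - nsq (x + y) = nsq (x - y).
  exact: nsq_ge0.
rewrite /nsq !linearDl !linearDr !linearNl !linearNr /=.
by case: (inner x y) (inner y x) (inner x x) (inner y y) => ? ? [? ?] [? ?] [? ?] /=; ring.
Qed.

Lemma hilbert_nsq (K : hilbertType R) (x : K) : nsq x = sqn x.
Proof. by rewrite /nsq sqn_inner. Qed.

Definition nsq_bounded (V : innerProductType R) (A : V -> V) :=
  exists C : R, forall x, nsq (A x) <= C * nsq x.

(** A bound M of the norm gives the bound M ^+ 2 of the squared norm; conversely
    a bound M of the squared norm gives the bound sqrt `|M| of the norm, whatever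
    the sign of M. *)
Lemma bounded_operatorP (K : hilbertType R) (A : {linear K -> K}) :
  bounded_operator A <-> nsq_bounded A.
Proof.
split=> -[M AM].
  exists (M ^+ 2) => x; rewrite !hilbert_nsq /sqn -exprMn.
  have := AM x; rewrite (norm_Re x) (norm_Re (A x)) -rmorphM lecR => h.
  rewrite ler_pXn2r// nnegrE ?Re_norm_ge0//.
  exact: le_trans (Re_norm_ge0 _) h.
exists (Num.sqrt `|M|) => x; rewrite (norm_Re x) (norm_Re (A x)) -rmorphM lecR.
rewrite -(ler_pXn2r (n := 2))// ?nnegrE ?Re_norm_ge0 ?mulr_ge0 ?Re_norm_ge0 ?sqrtr_ge0//.
rewrite exprMn sqr_sqrtr//; have := AM x; rewrite !hilbert_nsq => /le_trans; apply.
by rewrite ler_wpM2r ?sqn_ge0// ler_norm.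
Qed.

Lemma unitary_nsq (V W : innerProductType R) (Q : {linear V -> W}) :
  unitary Q -> forall x, nsq (Q x) = nsq x.
Proof. by move=> [Qi _] x; rewrite /nsq Qi. Qed.

Lemma unitary_inj (V W : innerProductType R) (Q : {linear V -> W}) :
  unitary Q -> injective Q.
Proof.
move=> uQ x y /eqP; rewrite -subr_eq0 -linearB => /eqP Qxy.
by apply/eqP; rewrite -subr_eq0; apply/eqP/nsq_eq0; rewrite -(unitary_nsq uQ) Qxy nsq0.
Qed.

Lemma unitary_inverse (V W : innerProductType R) (Q : {linear V -> W}) :
  unitary Q -> exists2 P : {linear W -> V}, unitary P & cancel P Q.
Proof.
move=> uQ; have [Qi Qs] := uQ; have Qinj := unitary_inj uQ.
pose p y := sval (cid (Qs y)); have pK y : Q (p y) = y by rewrite /p; case: cid.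
have p_linear : linear p by move=> a x y; apply: Qinj; rewrite linearP !pK.
pose m := GRing.isLinear.Build R[i] W V *:%R p p_linear.
pose P : {linear W -> V} := HB.pack p m.
exists P => //; split=> [x y|x]; first by rewrite -Qi !pK.
by exists (Q x); apply: Qinj; rewrite pK.
Qed.

(** Bounded operators and their algebraic relations move along Q as
    B = Q A Q^-1, so that the theorem can be proved on L^2(mu, H) itself. *)
Lemma unitary_transport (V W : innerProductType R) (Q : {linear V -> W})
    (A : {linear V -> V}) : unitary Q -> nsq_bounded A ->
  exists B : {linear W -> W}, nsq_bounded B /\ forall x, B (Q x) = Q (A x).
Proof.
move=> uQ [C AC]; have [P uP PK] := unitary_inverse uQ.
pose B : {linear W -> W} := (Q \o A \o P)%FUN.
exists B; split=> [|x]; last first.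
  by rewrite /B /=; congr (Q (A _)); apply: (unitary_inj uQ); rewrite PK.
by exists C => x; rewrite /B /= (unitary_nsq uQ) -[in leRHS](unitary_nsq uP).
Qed.

End SquaredNorm.

(** * Pointwise operators on L^2 *)

Section FiberwiseOperators.
Context d (T : measurableType d) (R : realType).
Variables (mu : {measure set T -> \bar R}) (H : hilbertType R).
Implicit Types (x y : L2space mu H) (F : T -> H -> H).

(** All computations in L^2 go through chosen representatives: an equation holds
    in L^2 as soon as it holds at almost every point for these. *)
Lemma L2space_aeP x y : x = y <-> {ae mu, forall t, L2repr x t = L2repr y t}.
Proof. by rewrite -{1}(L2reprK x) -{1}(L2reprK y); exact: L2classP. Qed.

Lemma L2repr_class (f : L2fun mu H) :
  {ae mu, forall t, L2repr (L2class f) t = f t}.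
Proof. by apply/L2classP; rewrite L2reprK. Qed.

Lemma L2repr_lin a x y :
  {ae mu, forall t, L2repr (a *: x + y) t = a *: L2repr x t + L2repr y t}.
Proof.
suff -> : a *: x + y = L2class (a *: L2repr x + L2repr y) by exact: L2repr_class.
by rewrite L2classD L2classZ !L2reprK.
Qed.

Lemma L2repr0 : {ae mu, forall t, L2repr (0 : L2space mu H) t = 0}.
Proof.
suff -> : 0 = L2class (0 : L2fun mu H) by exact: L2repr_class.
by rewrite -(scale0r (0 : L2fun mu H)) L2classZ -[RHS]/(0 *: L2class _) scale0r.
Qed.

Lemma L2reprZ a x : {ae mu, forall t, L2repr (a *: x) t = a *: L2repr x t}.
Proof.
have := L2repr_lin a x 0; rewrite addr0.
by apply: filterS2 L2repr0 => t ->; rewrite addr0.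
Qed.

Lemma L2reprB x y :
  {ae mu, forall t, L2repr (x - y) t = L2repr x t - L2repr y t}.
Proof.
have := L2repr_lin (-1) y x; rewrite scaleN1r addrC.
by apply: filterS => t ->; rewrite scaleN1r addrC.
Qed.

Lemma nsq_L2 x : nsq x = \int[mu]_t sqn (L2repr x t).
Proof. by apply: eq_Rintegral => t _; rewrite sqn_inner. Qed.

(** The families of fibre maps F t : H -> H that act on L^2(mu, H) by
    f |-> (t |-> F t (f t)) as a bounded operator. *)
Definition fiberwise F :=
  [/\ forall t, linear (F t),
      forall f : T -> H, strongly_measurable f ->
        strongly_measurable (fun t => F t (f t)) &
      exists C : R, forall t v, sqn (F t v) <= C * sqn v].

(** The default value 0 of insubd makes the operator total; for a fiberwise
    family it is never taken. *)
Definition L2lift F x : L2space mu H :=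
  L2class (insubd 0 (fun t => F t (L2repr x t))).

Lemma fiberwise_L2 F (f : L2fun mu H) : fiberwise F ->
  (fun t => F t (f t)) \in L2 mu H.
Proof.
move=> [_ mF [C FC]]; have /L2P[mf fi] := L2valP f.
apply: (L2_bounded (g := fun t => C * sqn (f t))) => //; first exact: mF.
rewrite (_ : _ \o _ = (fun t => C%:E * (EFin \o (fun t => sqn (f t))) t)%E)//.
exact: integrableZl.
Qed.

Lemma L2lift_ae F x : fiberwise F ->
  {ae mu, forall t, L2repr (L2lift F x) t = F t (L2repr x t)}.
Proof.
move=> FF; have := L2repr_class (insubd 0 (fun t => F t (L2repr x t))).
by apply: filterS => t ->; rewrite insubdK//; exact: fiberwise_L2.
Qed.

Lemma L2liftP F x y : fiberwise F ->
  y = L2lift F x <-> {ae mu, forall t, L2repr y t = F t (L2repr x t)}.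
Proof.
move=> FF; split=> [->|yF]; first exact: L2lift_ae.
by apply/L2space_aeP; apply: filterS2 yF (L2lift_ae x FF) => t -> ->.
Qed.

Lemma L2lift_linear F : fiberwise F -> linear (L2lift F).
Proof.
move=> FF a x y; apply/esym/L2liftP => //.
apply: filter_app (L2repr_lin a (L2lift F x) (L2lift F y)).
apply: filter_app (L2repr_lin a x y); apply: filter_app (L2lift_ae x FF).
apply: filterS (L2lift_ae y FF) => t Ey Ex Exy ->.
by rewrite Ex Ey Exy; case: FF => ->.
Qed.

Lemma L2lift_bounded F : fiberwise F -> nsq_bounded (L2lift F).
Proof.
move=> FF; have [_ _ [C FC]] := FF; exists C => x.
rewrite !nsq_L2 -RintegralZl//; last exact: L2fun_sqn.
rewrite (_ : \int[mu]_t _ = \int[mu]_t sqn (F t (L2repr x t))); last first.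
  congr fine; apply: ae_eq_integral => //.
  - exact: measurable_int (L2fun_sqn _).
  - exact: measurable_int (L2fun_sqn (MkL2fun (fiberwise_L2 _ FF))).
  - by apply: filterS (L2lift_ae x FF) => t ->.
apply: le_Rintegral => //.
- exact: (L2fun_sqn (MkL2fun (fiberwise_L2 _ FF))).
- rewrite (_ : _ \o _ = (fun t => C%:E * (EFin \o (fun t => sqn (L2repr x t))) t)%E)//.
  by apply: integrableZl => //; exact: L2fun_sqn.
Qed.

Definition L2op F (FF : fiberwise F) : {linear L2space mu H -> L2space mu H} :=
  HB.pack (L2lift F)
    (GRing.isLinear.Build R[i] (L2space mu H) (L2space mu H) *:%R (L2lift F)
       (L2lift_linear FF)).

End FiberwiseOperators.

(** * Polynomials that converge to a step function *)

Section Smoothstep.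
Context (R : realType).

(** The cubic 3 u^2 - 2 u^3 maps [0, 1] to itself with fixed points 0, 1/2 and 1;
    the middle one is repelling, so the iterates push [0, 1/2) to 0 and (1/2, 1]
    to 1. Being polynomial, they stay inside any algebra of functions. *)
Definition smoothstep (u : R) : R := u ^+ 2 * (3 - 2 * u).

Lemma smoothstep01 u : 0 <= u <= 1 -> 0 <= smoothstep u <= 1.
Proof.
move=> /andP[u0 u1]; rewrite /smoothstep mulr_ge0 ?sqr_ge0//=; last by lra.
rewrite -subr_ge0 (_ : _ - _ = (1 - u) ^+ 2 * (1 + 2 * u)); last by ring.
by rewrite mulr_ge0 ?sqr_ge0//; lra.
Qed.

Lemma iter_smoothstep01 u n : 0 <= u <= 1 -> 0 <= iter n smoothstep u <= 1.
Proof. by move=> u01; elim: n => //= n; exact: smoothstep01. Qed.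

(** The symmetry about 1/2 reduces the behaviour above 1/2 to that below. *)
Lemma iter_smoothstepN u n :
  iter n smoothstep (1 - u) = 1 - iter n smoothstep u.
Proof.
by elim: n => //= n ->; rewrite /smoothstep; ring.
Qed.

Lemma iter_smoothstep_half n : iter n smoothstep 2^-1 = 2^-1.
Proof.
elim: n => //= n ->; rewrite /smoothstep.
have h : (2 : R) != 0 by []. by field.
Qed.

(** One step multiplies u by r = u (3 - 2 u), which is less than 1 below 1/2;
    later iterates are smaller, hence contract at least as fast. *)
Lemma iter_smoothstep_cvg0 u : 0 <= u < 2^-1 ->
  iter n smoothstep u @[n --> \oo] --> 0.
Proof.
move=> /andP[u0 u1]; pose r := u * (3 - 2 * u).
have r0 : 0 <= r by rewrite mulr_ge0//; lra.
have r1 : r < 1 by rewrite /r; nra.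
have iter_le n : 0 <= iter n smoothstep u <= u * r ^+ n.
  elim: n => [|n /andP[v0 vu]] /=; first by rewrite expr0 mulr1 u0 lexx.
  have vle : iter n smoothstep u <= u.
    by apply: le_trans vu _; rewrite ler_piMr// exprn_ile1// ltW.
  move: v0 vu vle; set v := iter _ _ _ => v0 vu vle.
  rewrite /smoothstep mulr_ge0 ?sqr_ge0//=; last by lra.
  have vr : v * (3 - 2 * v) <= r by rewrite /r; nra.
  rewrite expr2 -mulrA (le_trans (ler_wpM2l v0 vr))// exprSr mulrA.
  by rewrite ler_wpM2r.
apply: (@squeeze_cvgr _ _ _ _ (fun=> 0) (geometric u r)).
- by near=> n; exact: iter_le.
- exact: cvg_cst.
- by apply: cvg_geometric; rewrite ger0_norm.
Unshelve. all: by end_near. Qed.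

(** The iterates of smoothstep tend to 0, 1/2 or 1, and l (2 l - 1) sends these
    limits to 0, 0 and 1: the value at the threshold is thereby corrected, and the
    limit is the indicator of u > 1/2. *)
Definition sharpen (u : R) (n : nat) : R :=
  iter n smoothstep u * (2 * iter n smoothstep u - 1).

Lemma sharpen_bound u n : 0 <= u <= 1 -> `|sharpen u n| <= 1.
Proof.
move=> /(iter_smoothstep01 n); rewrite /sharpen.
by set v := iter _ _ _ => /andP[v0 v1]; rewrite ler_norml; apply/andP; split; nra.
Qed.

Lemma sharpen_cvg u : 0 <= u <= 1 ->
  sharpen u n @[n --> \oo] --> ((2^-1 < u)%R%:R : R).
Proof.
move=> u01; have [l lE ul] : exists2 l : R, l * (2 * l - 1) = (2^-1 < u)%R%:R &
    iter n smoothstep u @[n --> \oo] --> l.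
  have [ult|ugt|->] := ltgtP u 2^-1.
  - by exists 0; [rewrite mul0r|apply: iter_smoothstep_cvg0; lra].
  - exists 1; first by rewrite /=; ring.
    rewrite (_ : (fun n => _) = (fun n => 1 - iter n smoothstep (1 - u))).
      rewrite -[X in _ --> X]subr0; apply: cvgB; first exact: cvg_cst.
      by apply: iter_smoothstep_cvg0; lra.
    by apply/funext => n; rewrite iter_smoothstepN; lra.
  - exists 2^-1; first by rewrite /=; lra.
    by under eq_fun do rewrite iter_smoothstep_half; exact: cvg_cst.
rewrite -lE; apply: cvgM => //; apply: cvgB; last exact: cvg_cst.
by apply: cvgM => //; exact: cvg_cst.
Qed.

End Smoothstep.

(** * Multiplication by bounded real functions *)

Section RealMultipliers.
Context d (T : measurableType d) (R : realType).

Lemma open_realC (B : set R[i]^o) : open B -> open [set r : R | B r%:C].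
Proof.
rewrite openE => oB; rewrite openE => r /= /oB/nbhs_ballP[e /= e0 eB].
apply/nbhs_ballP; exists (complex.Re e) => /=; first by rewrite -ltcR -gt0_complexE.
move=> s; rewrite -ball_normE /= => rs; apply: eB; rewrite -ball_normE /=.
by rewrite (gt0_complexE e0) -rmorphB normc_def /= expr0n addr0 sqrtr_sqr ltcR.
Qed.

(** The range is separable because rationals are dense in the real line. *)
Lemma strongly_measurable_realC (phi : T -> R) : measurable_fun setT phi ->
  strongly_measurable (fun t => (phi t)%:C : R[i]^o).
Proof.
move=> mphi; split.
  apply: (@measurability _ _ T (borel R[i]^o) setT _ (@open R[i]^o)) => //.
  move=> _ [B oB <-]; rewrite setTI.
  rewrite -[X in measurable X]setTI; apply: (mphi measurableT [set r | B r%:C]).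
  by apply: open_measurable; exact: open_realC.
exists (range (fun q : rat => (ratr q)%:C : R[i]^o)).
  exact: sub_countable (card_image_le _ _) (countableP _).
move=> _ [t _ <-] B /nbhs_ballP [e /= e0 eB].
have [q qt] : exists q : rat, `|phi t - ratr q| < complex.Re e.
  by apply: ex_rat_near; rewrite -ltcR -gt0_complexE.
exists (ratr q)%:C; split; first by exists q.
apply: eB; rewrite -ball_normE /=.
by rewrite (gt0_complexE e0) -rmorphB normc_def /= expr0n addr0 sqrtr_sqr ltcR.
Qed.

Definition multiplier (phi : T -> R) :=
  measurable_fun setT phi /\ exists C : R, forall t, `|phi t| <= C.

Variable H : hilbertType R.

Definition realmul (phi : T -> R) (t : T) (v : H) : H := (phi t)%:C *: v.

Lemma sqn_realmul phi t v : sqn (realmul phi t v) = phi t ^+ 2 * sqn v.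
Proof. by rewrite sqnZ normc_def /= expr0n addr0 sqrtr_sqr real_normK ?num_real. Qed.

Lemma multiplier_fiberwise phi : multiplier phi -> fiberwise (realmul phi).
Proof.
move=> [mphi [C phiC]]; split=> [t a u v|f mf|].
- by rewrite /realmul scalerDr !scalerA mulrC.
- exact: strongly_measurableZ (strongly_measurable_realC mphi) mf.
- exists (C ^+ 2) => t v; rewrite sqn_realmul ler_wpM2r ?sqn_ge0//.
  rewrite -[leLHS]real_normK ?num_real// ler_pXn2r// nnegrE//.
  exact: le_trans (normr_ge0 _) (phiC t).
Qed.

End RealMultipliers.

(** * Multipliers that commute with an operator *)

Section CommutingMultipliers.
Context d (T : measurableType d) (R : realType).
Variables (mu : {measure set T -> \bar R}) (H : hilbertType R).
Variable S : {linear L2space mu H -> L2space mu H}.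
Hypothesis S_bounded : nsq_bounded S.

Local Notation mul phi := (L2lift (mu := mu) (@realmul _ T R H phi)).

(** The symbols of multiplication operators commuting with S. They form an
    algebra that is stable under bounded pointwise limits (commuting_lim); the aim
    is that they exhaust all bounded measurable functions. *)
Definition commuting (phi : T -> R) :=
  multiplier phi /\ forall x, S (mul phi x) = mul phi (S x).

Lemma realmul_ae phi x : multiplier phi ->
  {ae mu, forall t, L2repr (mul phi x) t = (phi t)%:C *: L2repr x t}.
Proof. by move=> mphi; apply: L2lift_ae; exact: multiplier_fiberwise. Qed.

Lemma realmul_eq phi x y : multiplier phi ->
  {ae mu, forall t, L2repr y t = (phi t)%:C *: L2repr x t} -> mul phi x = y.
Proof.
by move=> mphi xy; apply/esym/L2liftP => //; exact: multiplier_fiberwise.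
Qed.

Lemma commuting_cst c : commuting (cst c).
Proof.
have mc : multiplier (cst c : T -> R).
  by split; [exact: measurable_cst|exists `|c|].
have mulc x : mul (cst c) x = c%:C *: x by apply: realmul_eq => //; exact: L2reprZ.
by split=> // x; rewrite !mulc linearZ.
Qed.

Lemma commutingD phi psi : commuting phi -> commuting psi ->
  commuting (fun t => phi t + psi t).
Proof.
move=> [mphi Sphi] [mpsi Spsi]; have m : multiplier (fun t => phi t + psi t).
  have [[m1 [C phiC]] [m2 [D psiD]]] := (mphi, mpsi).
  split; first exact: measurable_funD.
  by exists (C + D) => t; rewrite (le_trans (ler_normD _ _))// lerD.
have mulD x : mul (fun t => phi t + psi t) x = mul phi x + mul psi x.
  apply: realmul_eq => //; have := L2repr_lin 1 (mul phi x) (mul psi x).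
  rewrite scale1r; apply: filter_app; apply: filter_app (realmul_ae x mphi).
  apply: filterS (realmul_ae x mpsi) => t -> -> ->.
  by rewrite scale1r -scalerDl -rmorphD.
by split=> // x; rewrite !mulD linearD Sphi Spsi.
Qed.

Lemma commutingM phi psi : commuting phi -> commuting psi ->
  commuting (fun t => phi t * psi t).
Proof.
move=> [mphi Sphi] [mpsi Spsi]; have m : multiplier (fun t => phi t * psi t).
  have [[m1 [C phiC]] [m2 [D psiD]]] := (mphi, mpsi).
  split; first exact: measurable_funM.
  by exists (C * D) => t; rewrite normrM ler_pM.
have mulM x : mul (fun t => phi t * psi t) x = mul phi (mul psi x).
  apply: realmul_eq => //; apply: filter_app (realmul_ae (mul psi x) mphi).
  by apply: filterS (realmul_ae x mpsi) => t -> ->; rewrite scalerA -rmorphM.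
by split=> // x; rewrite !mulM Sphi Spsi.
Qed.

Lemma commutingZ c phi : commuting phi -> commuting (fun t => c * phi t).
Proof. by move=> ?; apply: (commutingM (commuting_cst c)). Qed.

Lemma commuting_sum n (phi : 'I_n -> T -> R) : (forall i, commuting (phi i)) ->
  commuting (fun t => \sum_(i < n) phi i t).
Proof.
elim: n phi => [|n IHn] phi Sphi.
  rewrite (_ : (fun _ => _) = cst 0); first exact: commuting_cst.
  by apply/funext => t; rewrite big_ord0.
rewrite (_ : (fun _ => _) = (fun t => phi ord0 t + \sum_(i < n) phi (lift ord0 i) t)).
  by apply: commutingD => //; exact: IHn.
by apply/funext => t; rewrite big_ord_recl.
Qed.

(** Strong convergence of multiplication operators, by dominated convergence:
    (phi_n - phi)^2 |x|^2 is dominated by (2C)^2 |x|^2. *)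
Lemma realmul_cvg (phi_ : nat -> T -> R) (phi : T -> R) (C : R) x :
  (forall n, measurable_fun setT (phi_ n)) ->
  (forall n t, `|phi_ n t| <= C) ->
  (forall t, phi_ n t @[n --> \oo] --> phi t) ->
  multiplier phi /\
  nsq (mul (phi_ n) x - mul phi x) @[n --> \oo] --> (0 : R).
Proof.
move=> mphi_ phi_C phi_phi.
have mphi : measurable_fun setT phi.
  by apply: (measurable_fun_cvg mphi_) => t _; exact: phi_phi.
have phiC t : `|phi t| <= C.
  by apply: (ler_cvg_to (cvg_norm (phi_phi t)) (cvg_cst C)); exact: nearW.
have m : multiplier phi by split; last exists C.
split=> //.
have nsqE n : nsq (mul (phi_ n) x - mul phi x) =
    fine (\int[mu]_t ((phi_ n t - phi t) ^+ 2 * sqn (L2repr x t))%:E)%E.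
  rewrite nsq_L2; congr fine; apply: ae_eq_integral => //.
  - exact: measurable_int (L2fun_sqn _).
  - apply/measurable_EFinP; apply: measurable_funM.
      by apply/measurable_funX/measurable_funB.
    by have /measurable_int/measurable_EFinP := L2fun_sqn (L2repr x).
  have mn : multiplier (phi_ n) by split=> //; exists C.
  apply: filter_app (L2reprB (mul (phi_ n) x) (mul phi x)).
  apply: filter_app (realmul_ae x mn); apply: filterS (realmul_ae x m) => t -> -> -> _ /=.
  by rewrite -scalerBl -rmorphB -(sqn_realmul (fun t => phi_ n t - phi t)).
under eq_fun do rewrite nsqE.
apply: fine_cvg; rewrite [X in _ --> X](_ : _ = \int[mu]_t (cst 0%E t))%E; last first.
  by rewrite integral0.
apply: (@dominated_cvg _ _ _ _ setT measurableT _ _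
  (fun t => ((C + C) ^+ 2 * sqn (L2repr x t))%:E)) => //.
- move=> n; apply/measurable_EFinP; apply: measurable_funM.
    by apply/measurable_funX/measurable_funB.
  by have /measurable_int/measurable_EFinP := L2fun_sqn (L2repr x).
- move=> t _; apply/fine_cvgP; split; first exact: nearW.
  rewrite [X in _ --> X](_ : _ = (phi t - phi t) ^+ 2 * sqn (L2repr x t)).
    apply: cvgM; last exact: cvg_cst.
    rewrite [X in _ --> X]expr2; under eq_fun do rewrite expr2.
    by apply: cvgM; apply: cvgB => //; exact: cvg_cst.
  by rewrite subrr expr0n mul0r.
- rewrite (_ : (fun t => _) =
    (fun t => ((C + C) ^+ 2)%:E * (EFin \o (fun t => sqn (L2repr x t))) t)%E)//.
  by apply: integrableZl => //; exact: L2fun_sqn.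
- move=> n t _; rewrite lee_fin ger0_norm; last first.
    by apply: mulr_ge0; [exact: sqr_ge0|exact: sqn_ge0].
  rewrite ler_wpM2r ?sqn_ge0// -[leLHS]real_normK ?num_real//.
  have C0 : 0 <= C by exact: le_trans (normr_ge0 _) (phiC t).
  rewrite ler_pXn2r// ?nnegrE ?addr_ge0//.
  by rewrite (le_trans (ler_normB _ _))// lerD.
Qed.

(** Both S (phi_n x) and phi_n (S x) converge in norm, the first because S is
    bounded, the second by realmul_cvg applied to S x; they are equal for every n,
    so their limits are equal. *)
Lemma commuting_lim (phi_ : nat -> T -> R) (phi : T -> R) (C : R) :
  (forall n, commuting (phi_ n)) ->
  (forall n t, `|phi_ n t| <= C) ->
  (forall t, phi_ n t @[n --> \oo] --> phi t) ->
  commuting phi.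
Proof.
move=> Sphi_ phi_C phi_phi.
have mphi_ n : measurable_fun setT (phi_ n) by case: (Sphi_ n) => -[].
have h x := realmul_cvg x mphi_ phi_C phi_phi.
split=> [|x]; first by case: (h 0).
have [[_ cx] [_ cSx]] := (h x, h (S x)); have [M SM] := S_bounded.
apply/eqP; rewrite -subr_eq0; apply/eqP/nsq_eq0/eqP.
rewrite eq_le nsq_ge0 andbT.
(* An upper bound, tending to 0, of the squared norm of S (phi x) - phi (S x). *)
pose r n := 2 * (M * nsq (mul (phi_ n) x - mul phi x)) +
  2 * nsq (mul (phi_ n) (S x) - mul phi (S x)).
have cr : r n @[n --> \oo] --> 2 * (M * 0) + 2 * 0.
  apply: cvgD; apply: cvgM; [exact: cvg_cst| |exact: cvg_cst|].
    apply: cvgM; [exact: cvg_cst|exact: cx].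
  exact: cSx.
rewrite !mulr0 addr0 in cr.
apply: (ler_cvg_to (cvg_cst (nsq (S (mul phi x) - mul phi (S x)))) cr).
apply: nearW => n; rewrite /r.
  rewrite -(subrKA (mul (phi_ n) (S x))) (le_trans (nsqD_le _ _))// lerD2r.
  case: (Sphi_ n) => _ <-; rewrite -linearB -nsqN -linearN opprB.
  by rewrite ler_pM2l.
Qed.

End CommutingMultipliers.

Section CommutingSets.
Context d (T : measurableType d) (R : realType).
Variables (mu : {measure set T -> \bar R}) (H : hilbertType R).
Variable S : {linear L2space mu H -> L2space mu H}.
Hypothesis S_bounded : nsq_bounded S.

(** After an affine change of variable that brings phi into [0, 1] and c to 1/2,
    the indicator is the limit of the polynomials sharpen. *)
Lemma commuting_gt phi c : commuting S phi ->
  commuting S (\1_[set t | c < phi t] : T -> R).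
Proof.
move=> Sphi; have [[mphi [C phiC]] _] := Sphi.
(* The slope 1 / K is small enough for |u - 1/2| <= 1/2, as |phi - c| <= K / 2. *)
pose K := 2 * (`|C| + `|c| + 1); pose u t := 2^-1 - c / K + K^-1 * phi t.
have K0 : 0 < K by rewrite mulr_gt0// ltr_wpDl// addr_ge0.
have uE t : u t = 2^-1 + (phi t - c) / K by rewrite /u; ring.
have u01 t : 0 <= u t <= 1.
  suff : `|(phi t - c) / K| <= 2^-1 by rewrite uE ler_norml; lra.
  rewrite normrM normfV (gtr0_norm K0) ler_pdivrMr// /K mulKf//.
  have := ler_norm C; have := ler_normB (phi t) c; have := phiC t; lra.
have Su : commuting S u.
  by apply: commutingD; [exact: commuting_cst|exact: commutingZ].
have Siter n : commuting S (fun t => iter n (@smoothstep R) (u t)).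
  elim: n => //= n IHn; apply: commutingM; first exact: commutingM.
  rewrite (_ : (fun _ => _) =
    (fun t => 3 + (-2) * iter n (@smoothstep R) (u t))).
    by apply: commutingD; [exact: commuting_cst|exact: commutingZ].
  by apply/funext => t; rewrite mulNr.
apply: (commuting_lim S_bounded (phi_ := fun n t => sharpen (u t) n) (C := 1)).
- move=> n; apply: commutingM => //.
  rewrite (_ : (fun _ => _) = (fun t => -1 + 2 * iter n (@smoothstep R) (u t))).
    by apply: commutingD; [exact: commuting_cst|exact: commutingZ].
  by apply/funext => t; rewrite addrC.
- by move=> n t; exact: sharpen_bound.
- move=> t; rewrite [X in _ --> X](_ : _ = (2^-1 < u t)%R%:R); last first.
    rewrite indicE uE ltrDl pmulr_lgt0 ?invr_gt0// subr_gt0.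
    by case: ltP => h; [rewrite mem_set|rewrite memNset//= ltNge h].
  exact: sharpen_cvg.
Qed.

(** These are the spectral projections that commute with S. *)
Definition commuting_sets : set (set T) := [set A | commuting S (\1_A : T -> R)].

Lemma commuting_setU A B : commuting_sets A -> commuting_sets B ->
  commuting_sets (A `|` B).
Proof.
rewrite /commuting_sets /= => SA SB.
rewrite (_ : \1_(A `|` B) =
  (fun t => \1_A t + (\1_B t + (-1) * (\1_A t * \1_B t)))); last first.
  apply/funext => t; rewrite !indicE in_setU.
  by case: (t \in A); case: (t \in B) => /=; ring.
by apply: commutingD => //; apply: commutingD => //; apply/commutingZ/commutingM.
Qed.

(** Complements and finite unions are polynomial in the indicators, and a
    countable union is the bounded pointwise limit of finite ones. *)
Lemma commuting_sets_sigma_algebra : sigma_algebra setT commuting_sets.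
Proof.
have S0 : commuting_sets set0.
  by rewrite /commuting_sets /= indic0; exact: commuting_cst.
split=> // [A SA|A SA].
  rewrite /commuting_sets /= (_ : \1_(setT `\` A) = (fun t => 1 + (-1) * \1_A t)).
    by apply: commutingD; [exact: commuting_cst|exact: commutingZ].
  apply/funext => t; rewrite !indicE setTD in_setC.
  by case: (t \in A) => /=; ring.
apply: (commuting_lim S_bounded
  (phi_ := fun n => \1_(\big[setU/set0]_(i < n) A i)) (C := 1)).
- by move=> n; apply: (big_ind commuting_sets) => // ? ?; exact: commuting_setU.
- by move=> n t; rewrite indicE; case: (_ \in _); rewrite ?normr1 ?normr0.
- move=> t; apply: cvg_near_cst; rewrite indicE.
  have [/set_mem[k _ Akt]|tA] := boolP (t \in \bigcup_k A k).
    near=> n; rewrite indicE mem_set//=; rewrite -bigcup_mkord.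
    by exists k => //=; near: n; exact: nbhs_infty_gt.
  apply: nearW => n; rewrite indicE memNset//= -bigcup_mkord => -[k /= _ Akt].
  by move/negP: tA; apply; rewrite inE; exists k.
Unshelve. all: by end_near. Qed.

Import HBNNSimple.

(** A bounded function, once shifted to be nonnegative, is a bounded limit of
    simple functions. *)
Lemma commuting_multiplier : measurable `<=` commuting_sets ->
  forall phi, multiplier phi -> commuting S phi.
Proof.
move=> Smeas phi [mphi [C phiC]].
pose f t := phi t + C.
have f0 t : 0 <= f t by have := phiC t; rewrite ler_norml /f; lra.
have mf : measurable_fun setT (EFin \o f).
  by apply/measurable_EFinP; exact: measurable_funD.
pose g := nnsfun_approx measurableT mf.
have gf t : g n t @[n --> \oo] --> f t.
  have f0' x : setT x -> (0 <= (EFin \o f) x)%E by rewrite lee_fin.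
  exact: fine_cvg (cvg_nnsfun_approx measurableT mf f0' (x := t) I).
have g_le n t : `|g n t| <= 2 * C.
  rewrite ger0_norm ?fun_ge0//; apply: (@le_trans _ _ (f t)).
    rewrite -(cvg_lim _ (gf t))//; apply: (@nondecreasing_cvgn_le _ (fun n => g n t)).
      by move=> m k mk; exact/lefP/nd_nnsfun_approx.
    by apply/cvg_ex; exists (f t).
  by have := phiC t; rewrite ler_norml /f; lra.
have Sg n : commuting S (g n).
  have -> := funext (fimfunEord (g n)).
  by apply: commuting_sum => i; apply: commutingZ; apply: Smeas.
have Sf := commuting_lim S_bounded Sg g_le gf.
rewrite (_ : phi = (fun t => - C + f t)).
  by apply: commutingD => //; exact: commuting_cst.
by apply/funext => t; rewrite /f; ring.
Qed.

End CommutingSets.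

(** * The commutant of multiplication by z *)

Section ComplexParts.
Context (R : realType).

Lemma open_Re_gt (a : R) : open [set z : R[i]^o | a < complex.Re z].
Proof.
rewrite openE => z /= az; apply/nbhs_ballP; exists (complex.Re z - a)%:C.
  by rewrite /= ltcR subr_gt0.
move=> w; rewrite -ball_normE => /ball_ReIm[zw _] /=.
by move: zw; rewrite ltr_norml; lra.
Qed.

Lemma open_Im_gt (a : R) : open [set z : R[i]^o | a < complex.Im z].
Proof.
rewrite openE => z /= az; apply/nbhs_ballP; exists (complex.Im z - a)%:C.
  by rewrite /= ltcR subr_gt0.
move=> w; rewrite -ball_normE => /ball_ReIm[_ zw] /=.
by move: zw; rewrite ltr_norml; lra.
Qed.

Context d (T : measurableType d).
Implicit Type f : T -> R[i]^o.

Lemma measurable_fun_gt (g : T -> R) :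
  (forall a, measurable [set t | a < g t]) -> measurable_fun setT g.
Proof.
move=> mg; apply: (measurability _ (RGenOInfty.measurableE R)) => /= _ [_ [a ->] <-].
by rewrite setTI preimage_itvoy; exact: mg.
Qed.

Lemma strongly_measurable_preimage f (B : set R[i]^o) :
  strongly_measurable f -> open B -> measurable (f @^-1` B).
Proof.
move=> [mf _] oB; rewrite -[X in measurable X]setTI; apply: mf => //.
exact: sub_sigma_algebra.
Qed.

Lemma measurable_Re f : strongly_measurable f ->
  measurable_fun setT (fun t => complex.Re (f t)).
Proof.
move=> mf; apply: measurable_fun_gt => a.
exact: strongly_measurable_preimage mf (@open_Re_gt a).
Qed.

Lemma measurable_Im f : strongly_measurable f ->
  measurable_fun setT (fun t => complex.Im (f t)).
Proof.
move=> mf; apply: measurable_fun_gt => a.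
exact: strongly_measurable_preimage mf (@open_Im_gt a).
Qed.

(** Real and imaginary part decide strong measurability because the scalars are
    separable. *)
Lemma strongly_measurable_complex (f : T -> R[i]^o) :
  measurable_fun setT (fun t => complex.Re (f t)) ->
  measurable_fun setT (fun t => complex.Im (f t)) -> strongly_measurable f.
Proof.
move=> mRe mIm; rewrite (_ : f = (fun t => (complex.Re (f t))%:C +
    (('i%C : R[i]) *: ((complex.Im (f t))%:C : R[i]^o)))).
  apply: strongly_measurableD; first exact: strongly_measurable_realC.
  apply: (@strongly_measurableZ _ _ _ R[i]^o (fun=> 'i%C)).
    exact: strongly_measurable_cst.
  exact: strongly_measurable_realC.
by apply/funext => t; rewrite [LHS]complexE.
Qed.

End ComplexParts.

Section CircleMultiplication.
Context (R : realType).
Variables (mu : {measure set (borel (circle R)) -> \bar R}) (H : hilbertType R).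

Lemma circle_val_neq0 (z : circle R) : circle_val z != 0 :> R[i].
Proof. by rewrite -(normr_eq0 (circle_val z : R[i]^o)) circle_val_norm oner_eq0. Qed.

Lemma circle_ReIm (z : circle R) :
  complex.Re (circle_val z) ^+ 2 + complex.Im (circle_val z) ^+ 2 = 1.
Proof.
apply: (@complexI R); rewrite add_Re2_Im2.
by rewrite (_ : `|_| = 1) ?expr1n//; exact: circle_val_norm.
Qed.

Lemma multiplier_Re : multiplier (fun z : borel (circle R) => complex.Re (circle_val z)).
Proof.
split; first exact: measurable_Re (@circle_val_measurable R).
exists 1 => z; rewrite ler_norml; have := circle_ReIm z; nra.
Qed.

Lemma multiplier_Im : multiplier (fun z : borel (circle R) => complex.Im (circle_val z)).
Proof.
split; first exact: measurable_Im (@circle_val_measurable R).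
exists 1 => z; rewrite ler_norml; have := circle_ReIm z; nra.
Qed.

Lemma mulz_ae (x : L2space mu H) :
  {ae mu, forall z, L2repr (mulz mu H x) z = circle_val z *: L2repr x z}.
Proof. exact: L2repr_class. Qed.

Lemma mulz_inj : injective (mulz mu H).
Proof.
move=> x y /L2space_aeP xy; apply/L2space_aeP.
apply: filter_app xy; apply: filter_app (mulz_ae x).
apply: filterS (mulz_ae y) => z -> ->.
by apply: scalerI; exact: circle_val_neq0.
Qed.

Variable S : {linear L2space mu H -> L2space mu H}.
Hypothesis S_bounded : nsq_bounded S.
Hypothesis S_mulz : forall x, S (mulz mu H x) = mulz mu H (S x).

(** On the circle conj z = 1 / z, so Re z and Im z are not polynomials in z, but z
    times either of them is. Commutation with phi follows from commutation with
    z because multiplication by z is injective. *)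
Lemma commuting_quadratic (phi : borel (circle R) -> R) (c e : R[i]) :
  multiplier phi -> c != 0 ->
  (forall z, circle_val z * (c * (phi z)%:C) = circle_val z ^+ 2 + e :> R[i]) ->
  commuting S phi.
Proof.
move=> mphi c0 phiE; split=> // x.
have key y : mulz mu H (c *: L2lift (realmul phi) y) = mulz mu H (mulz mu H y) + e *: y.
  apply/L2space_aeP.
  apply: filter_app (mulz_ae (c *: L2lift (realmul phi) y)).
  apply: filter_app (L2reprZ c (L2lift (realmul phi) y)).
  apply: filter_app (realmul_ae y mphi).
  have := L2repr_lin 1 (mulz mu H (mulz mu H y)) (e *: y).
  rewrite scale1r; apply: filter_app; apply: filter_app (L2reprZ e y).
  apply: filter_app (mulz_ae (mulz mu H y)); apply: filterS (mulz_ae y).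
  move=> z -> -> -> -> -> -> ->.
  by rewrite scale1r !scalerA -scalerDl -mulrA phiE expr2.
apply: (scalerI c0); apply: mulz_inj.
by rewrite key -S_mulz -linearZ -!S_mulz key linearD linearZ.
Qed.

Lemma commuting_Re : commuting S (fun z => complex.Re (circle_val z)).
Proof.
apply: (@commuting_quadratic _ 2 1); first exact: multiplier_Re.
  by [].
move=> z; have := circle_ReIm z; case: (circle_val z) => a b /= ab.
have -> : (2 : R[i]) = 2%:C by rewrite rmorph_nat.
rewrite expr2; apply/eqP; rewrite eq_complex /=; apply/andP; split; apply/eqP; lra.
Qed.

Lemma commuting_Im : commuting S (fun z => complex.Im (circle_val z)).
Proof.
apply: (@commuting_quadratic _ (2%:C * 'i%C) (- 1)); first exact: multiplier_Im.
  by rewrite mulf_neq0 ?neq0Ci// (inj_eq (@complexI R)).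
move=> z; have := circle_ReIm z; case: (circle_val z) => a b /= ab.
rewrite expr2; apply/eqP; rewrite eq_complex /=; apply/andP; split; apply/eqP; lra.
Qed.

(** The commuting sets form a sigma-algebra for which Re z and Im z are
    measurable, hence for which the inclusion of the circle in the plane is; every
    open set of the circle is the trace of an open set of the plane. *)
Lemma commuting_borel : measurable `<=` commuting_sets S.
Proof.
have sS := commuting_sets_sigma_algebra S_bounded.
(* The circle with the commuting sets as its measurable sets. *)
pose Tc := g_sigma_algebraType (commuting_sets S : set (set (circle R))).
have mTc (A : set Tc) : measurable A = commuting_sets S A.
  by rewrite -[in RHS](sigma_algebra_id sS).
have mval : strongly_measurable (circle_val (R := R) : Tc -> R[i]^o).
  apply: strongly_measurable_complex; apply: measurable_fun_gt => a; rewrite mTc.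
    by apply: commuting_gt => //; exact: commuting_Re.
  by apply: commuting_gt => //; exact: commuting_Im.
apply: smallest_sub => //= _ [B oB <-].
by have := strongly_measurable_preimage mval oB; rewrite mTc.
Qed.

End CircleMultiplication.

(** * Scalar functions: the commutant is abelian *)

Section ScalarCommutant.
Context d (T : measurableType d) (R : realType).
Variable mu : {finite_measure set T -> \bar R}.
Local Notation V := (L2space mu (scalar_space R)).

Lemma cst_L2 (H : hilbertType R) (v : H) : (fun _ : T => v) \in L2 mu H.
Proof.
apply: (@L2_bounded _ _ _ mu H _ (fun=> sqn v)) => //.
  exact: strongly_measurable_cst.
exact: finite_measure_integrable_cst.
Qed.

Definition L2cst (H : hilbertType R) (v : H) : L2space mu H :=
  L2class (MkL2fun (cst_L2 v)).

Lemma L2cst_ae (H : hilbertType R) (v : H) :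
  {ae mu, forall t, L2repr (L2cst v) t = v}.
Proof. exact: L2repr_class. Qed.

Lemma sqn_scalar (v : scalar_space R) :
  sqn v = complex.Re (v : R[i]) ^+ 2 + complex.Im (v : R[i]) ^+ 2.
Proof.
rewrite /sqn; have -> : `|v| = `|v : R[i]| by [].
by rewrite normc_def /= sqr_sqrtr// addr_ge0 ?sqr_ge0.
Qed.

(** An operator that commutes with all bounded multipliers is the multiplication
    by S 1, since formally S f = S (f 1) = f S 1. For an unbounded f this is
    applied to its truncations to the sets where |f|^2 <= n, which exhaust the
    space. *)
Lemma commuting_is_multiplication (S : {linear V -> V}) (f : V) :
  (forall phi, multiplier phi -> commuting S phi) ->
  {ae mu, forall t, L2repr (S f) t =
    (L2repr f t : R[i]) *: L2repr (S (L2cst (1 : scalar_space R))) t}.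
Proof.
move=> Smul; set one := L2cst _.
have one_ae : {ae mu, forall t, L2repr one t = (1 : R[i])} by exact: L2cst_ae.
have /L2P[mf _] := L2valP (L2repr f).
pose A n := [set t | sqn (L2repr f t) <= n%:R].
have mA n : measurable (A n).
  rewrite /A -[X in measurable X]setTI; apply: (measurable_fun_le (g := cst n%:R)).
  - by [].
  - exact: measurable_norm2.
  - exact: measurable_cst.
pose chi n : T -> R := \1_(A n).
pose phi n t := complex.Re (L2repr f t : R[i]) * chi n t.
pose psi n t := complex.Im (L2repr f t : R[i]) * chi n t.
have mchi n : multiplier (chi n).
  split; first exact: measurable_indic.
  by exists 1 => t; rewrite /chi indicE; case: (_ \in _); rewrite ?normr1 ?normr0.
have bound n t (r : R) : r ^+ 2 <= sqn (L2repr f t) -> `|r * chi n t| <= 1 + n%:R.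
  move=> rf; rewrite /chi indicE; case: (boolP (t \in A n)) => [/set_mem|_].
    rewrite /A /= mulr1 => /(le_trans rf) rn.
    rewrite ler_norml; have : 0 <= n%:R :> R by []. nra.
  by rewrite mulr0 normr0 addr_ge0.
have mphi n : multiplier (phi n).
  split; first by apply: measurable_funM; [exact: measurable_Re|case: (mchi n)].
  by exists (1 + n%:R) => t; apply: bound; rewrite sqn_scalar lerDl sqr_ge0.
have mpsi n : multiplier (psi n).
  split; first by apply: measurable_funM; [exact: measurable_Im|case: (mchi n)].
  by exists (1 + n%:R) => t; apply: bound; rewrite sqn_scalar lerDr sqr_ge0.
have split_value n t (y a b o : scalar_space R) : o = (1 : R[i]) ->
    a = (psi n t)%:C *: o -> b = (phi n t)%:C *: o -> y = 'i%C *: a + b ->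
    y = (chi n t)%:C *: L2repr f t.
  move=> -> -> -> ->; rewrite /phi /psi; case: (L2repr f t) => u v /=.
  by apply/eqP; rewrite eq_complex /=; apply/andP; split; apply/eqP; ring.
have join_value n t (y a b c o : scalar_space R) : (chi n t)%:C *: y = c ->
    a = (psi n t)%:C *: o -> b = (phi n t)%:C *: o -> c = 'i%C *: a + b ->
    chi n t = 1 -> y = (L2repr f t : R[i]) *: o.
  move=> yc ea eb ec chi1; move: yc; rewrite ec ea eb /phi /psi chi1 !mulr1 scale1r => ->.
  by rewrite scalerA -scalerDl addrC -complexE.
(* The truncated function as a combination of real multipliers applied to 1,
   to which the hypothesis on S applies. *)
have split_f n : L2lift (realmul (chi n)) f =
    'i%C *: L2lift (realmul (psi n)) one + L2lift (realmul (phi n)) one.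
  apply: realmul_eq => //.
  apply: filter_app (L2repr_lin 'i%C (L2lift (realmul (psi n)) one) (L2lift (realmul (phi n)) one)).
  apply: filter_app (realmul_ae one (mphi n)); apply: filter_app (realmul_ae one (mpsi n)).
  apply: filterS one_ae => t; exact: split_value.
have eq_on n : {ae mu, forall t, A n t -> L2repr (S f) t =
    (L2repr f t : R[i]) *: L2repr (S one) t}.
  have [_ Schi] := Smul _ (mchi n).
  have [_ Sphi] := Smul _ (mphi n).
  have [_ Spsi] := Smul _ (mpsi n).
  have /L2space_aeP : L2lift (realmul (chi n)) (S f) =
      'i%C *: L2lift (realmul (psi n)) (S one) + L2lift (realmul (phi n)) (S one).
    apply: (etrans (esym (Schi f))); apply: (etrans (congr1 S (split_f n))).
    apply: (etrans (linearP S _ _ _)).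
    exact: (congr2 (fun u v => 'i%C *: u + v) (Spsi one) (Sphi one)).
  apply: filter_app.
  apply: filter_app (L2repr_lin 'i%C (L2lift (realmul (psi n)) (S one)) (L2lift (realmul (phi n)) (S one))).
  apply: filter_app (realmul_ae (S one) (mphi n)).
  apply: filter_app (realmul_ae (S one) (mpsi n)).
  apply: filterS (realmul_ae (S f) (mchi n)) => t e1 e2 e3 e4 e5 At.
  apply: (join_value n t _ _ _ _ _ (etrans (esym e1) e5) e2 e3 e4).
  by rewrite /chi indicE mem_set.
apply: filterS (ae_foralln eq_on) => t; apply.
rewrite /A /= ; exact: ltW (truncnS_gt _).
Qed.

End ScalarCommutant.

Section ScalarTwist.
Context (R : realType).
Variable mu : {finite_measure set (borel (circle R)) -> \bar R}.
Local Notation V := (L2space mu (scalar_space R)).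
Local Notation M := (mulz mu (scalar_space R)).

(** Both operators are multiplications, by the images of the constant 1. *)
Lemma mulz_commutant_abelian (S T : {linear V -> V}) :
  nsq_bounded S -> nsq_bounded T ->
  (forall x, S (M x) = M (S x)) -> (forall x, T (M x) = M (T x)) ->
  forall x, S (T x) = T (S x).
Proof.
move=> Sb Tb SM TM x.
have mulS := @commuting_is_multiplication _ _ _ mu S ^~
  (commuting_multiplier Sb (commuting_borel Sb SM)).
have mulT := @commuting_is_multiplication _ _ _ mu T ^~
  (commuting_multiplier Tb (commuting_borel Tb TM)).
apply/L2space_aeP.
apply: filter_app (mulS (T x)); apply: filter_app (mulT (S x)).
apply: filter_app (mulS x); apply: filterS (mulT x) => z Tx Sx TSx STx.
apply: (etrans STx); apply: (etrans _ (esym TSx)).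
by rewrite Tx Sx; exact: mulrAC.
Qed.

Lemma measurable_circle1 : measurable ([set circle1 R] : set (borel (circle R))).
Proof.
have : open (~` [set (1 : R[i]^o)]).
  apply: closed_openC; apply: accessible_closed_set1.
  exact/hausdorff_accessible/norm_hausdorff.
move=> /(strongly_measurable_preimage (@circle_val_measurable R))/measurableC.
congr measurable; apply/seteqP; split => z /= => [/contrapT z1|-> //].
  exact: val_inj.
Qed.

(** Such a y satisfies (z - 1) y(z) = 0 almost everywhere, and z - 1 vanishes only
    at the point 1. *)
Lemma mulz_fixed (H : hilbertType R) (y : L2space mu H) :
  mu [set circle1 R] = 0%E -> mulz mu H y = y -> y = 0.
Proof.
move=> mu1 /L2space_aeP My; apply/L2space_aeP.
have n1 : {ae mu, forall z : borel (circle R), z <> circle1 R}.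
  by exists [set circle1 R]; split=> //; [exact: measurable_circle1|move=> z /= /contrapT].
apply: filter_app My; apply: filter_app (mulz_ae y); apply: filter_app (L2repr0 mu H).
apply: filterS n1 => z z1 -> -> /eqP.
rewrite -subr_eq0 -[X in _ - X]scale1r -scalerBl scaler_eq0 subr_eq0.
by case/orP => /eqP// zE; case: z1; apply: val_inj.
Qed.

End ScalarTwist.

(** * Vector functions: a pair of rank-one operators in the fibres *)

Section RankOne.
Context (R : realType) (H : hilbertType R).
Implicit Types a b v : H.

(** This is the Cauchy-Schwarz inequality for v and b: the squared norm of
    |b|^2 v - <v, b> b equals |b|^2 (|b|^2 |v|^2 - |<v, b>|^2) and is nonnegative. *)
Lemma sqn_rank_one a b v : sqn (inner v b *: a) <= sqn b * sqn a * sqn v.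
Proof.
have [->|b0] := eqVneq b 0.
  by rewrite linear0r scale0r /sqn normr0 /= expr0n !mul0r.
have B0 : 0 < sqn b by rewrite lt0r sqn_ge0 sqn_eq0 b0.
pose c := inner v b.
(* The squared norms are abstracted so that only bilinearity is expanded. *)
have residual (B V : R) : inner b b = B%:C -> inner v v = V%:C ->
    nsq (B%:C *: v - c *: b) =
    B * (B * V - (complex.Re c ^+ 2 + complex.Im c ^+ 2)).
  move=> bB vV; set r := RHS; rewrite /nsq !linearBl !linearBr !linearZl_LR !linearZr_LR /=.
  rewrite (inner_sym b v) -/c bB vV.
  by rewrite {}/r; case: c => p q /=; ring.
have := nsq_ge0 ((sqn b)%:C *: v - c *: b).
rewrite (residual _ _ (sqn_inner b) (sqn_inner v)) pmulr_rge0// subr_ge0.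
rewrite sqnZ -/c normc_def /= sqr_sqrtr ?addr_ge0 ?sqr_ge0// => h.
by rewrite [leRHS]mulrAC ler_wpM2r ?sqn_ge0.
Qed.

(** One step of the Gram-Schmidt process, without division. *)
Lemma ex_orthogonal_pair : dim_ge2 H ->
  exists a b : H, [/\ a != 0, b != 0 & inner a b = 0].
Proof.
move=> [u [v uv]].
have u0 : u != 0.
  apply/eqP => u0; have [|/eqP] := uv 1 0; first by rewrite u0 scaler0 scale0r addr0.
  by rewrite oner_eq0.
exists u, (inner u u *: v - inner v u *: u); split=> //.
  apply/eqP => b0; have [|_ /eqP] := uv (- inner v u) (inner u u).
    by rewrite scaleNr addrC.
  by rewrite sqn_inner (inj_eq (@complexI R)) sqn_eq0 (negbTE u0).
rewrite inner_sym linearBl !linearZl_LR /= mulrC subrr.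
by rewrite rmorph0.
Qed.

End RankOne.

Section FiberwiseExamples.
Context d (T : measurableType d) (R : realType) (H : hilbertType R).

(** Polarization expresses the real part of the inner product by squared norms of
    strongly measurable functions. *)
Lemma strongly_measurable_inner (f : T -> H) (b : H) : strongly_measurable f ->
  strongly_measurable (fun t => inner (f t) b : R[i]^o).
Proof.
have mRe (c : H) : strongly_measurable f ->
    measurable_fun setT (fun t => complex.Re (inner (f t) c)).
  move=> mf; under eq_fun do rewrite Re_inner.
  apply: measurable_funM; first exact: measurable_cst.
  apply: measurable_funB; apply: measurable_norm2; apply: strongly_measurableD => //;
    exact: strongly_measurable_cst.
move=> mf; apply: strongly_measurable_complex; first exact: mRe.
by under eq_fun do rewrite Im_inner; exact: mRe.
Qed.

Lemma fiberwise_rank_one (g : T -> R[i]^o) (a b : H) : strongly_measurable g ->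
  (forall t, `|g t| = 1) -> fiberwise (fun t v => g t *: (inner v b *: a)).
Proof.
move=> mg g1; split=> [t c u v|f mf|].
- by rewrite linearDl linearZl_LR /= scalerDl scalerDr !scalerA mulrCA mulrA.
- apply: strongly_measurableZ => //; apply: strongly_measurableZ.
    exact: strongly_measurable_inner.
  exact: strongly_measurable_cst.
- exists (sqn b * sqn a) => t v; rewrite sqnZ g1 expr1n mul1r.
  exact: sqn_rank_one.
Qed.

Lemma fiberwiseD (F G : T -> H -> H) : fiberwise F -> fiberwise G ->
  fiberwise (fun t v => F t v + G t v).
Proof.
move=> [lF mF [C FC]] [lG mG [D GD]]; split=> [t a u v|f mf|].
- by rewrite lF lG scalerDr addrACA.
- by apply: strongly_measurableD; [exact: mF|exact: mG].
- exists (2 * C + 2 * D) => t v; apply: le_trans (sqnD_le _ _) _.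
  by have := FC t v; have := GD t v; lra.
Qed.

End FiberwiseExamples.

Section VectorTwist.
Context (R : realType) (H : hilbertType R).
Variable mu : {finite_measure set (borel (circle R)) -> \bar R}.
Local Notation M := (mulz mu H).

(** Multiplication by z is a scalar in every fibre, hence commutes with linear
    fibre maps. *)
Lemma L2lift_mulz (F : borel (circle R) -> H -> H) (x : L2space mu H) :
  fiberwise F -> L2lift F (M x) = M (L2lift F x).
Proof.
move=> FF; apply/esym/L2liftP => //.
apply: filter_app (mulz_ae (L2lift F x)); apply: filter_app (mulz_ae x).
apply: filterS (L2lift_ae x FF) => z -> -> ->.
have [lF _ _] := FF; have F0 : F z 0 = 0.
  by have := lF z (-1) 0 0; rewrite !scaleN1r oppr0 addr0 addNr.
by have := lF z (circle_val z) (L2repr x z) 0; rewrite !addr0 F0 addr0.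
Qed.

(** Take orthogonal nonzero vectors a and b. In the fibres, let S send b to a
    multiple of a and annihilate a, and let T be diagonal on a and b with entries
    in the ratio 1 : z. Moving from b to a, ST picks the entry z of T and TS picks
    the entry 1, whence ST = z TS. The factors |a|^2 and |b|^2 below compensate for
    a and b not being normalized. *)
Lemma nontrivial_twist_model : mu setT != 0%E -> dim_ge2 H ->
  exists S T : {linear L2space mu H -> L2space mu H},
    [/\ nsq_bounded S /\ nsq_bounded T,
        forall x, M (S x) = S (M x), forall x, M (T x) = T (M x),
        forall x, S (T x) = M (T (S x)) & exists x, S (T x) <> 0].
Proof.
move=> mu0 /ex_orthogonal_pair[a [b [a0 b0 ab]]].
pose one : borel (circle R) -> R[i]^o := fun=> 1.
have m1 : strongly_measurable one by exact: strongly_measurable_cst.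
pose FS (z : borel (circle R)) (v : H) := one z *: (inner v b *: a).
pose FT (z : borel (circle R)) (v : H) :=
  one z *: (inner v a *: ((sqn b)%:C *: a)) +
  circle_val z *: (inner v b *: ((sqn a)%:C *: b)).
have fFS : fiberwise FS.
  by apply: fiberwise_rank_one => // z; rewrite normr1.
have fFT : fiberwise FT.
  apply: fiberwiseD; apply: fiberwise_rank_one => //.
  - by move=> z; rewrite normr1.
  - exact: circle_val_measurable.
  - exact: circle_val_norm.
have ST z v : FS z (FT z v) = circle_val z *: FT z (FS z v).
  rewrite /FS /FT /one !scale1r linearDl !linearZl_LR /= ab.
  rewrite !sqn_inner !mulr0 scale0r scaler0 add0r addr0.
  by rewrite !scalerA; congr (_ *: _); ring.
exists (L2op mu fFS), (L2op mu fFT); split=> [|x|x|x|].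
- by split; exact: L2lift_bounded.
- by rewrite [RHS]L2lift_mulz.
- by rewrite [RHS]L2lift_mulz.
- apply/L2space_aeP.
  apply: filter_app (mulz_ae (L2lift FT (L2lift FS x))).
  apply: filter_app (L2lift_ae (L2lift FT x) fFS).
  apply: filter_app (L2lift_ae (L2lift FS x) fFT).
  apply: filter_app (L2lift_ae x fFT).
  by apply: filterS (L2lift_ae x fFS) => z e1 e2 e3 e4 e5; rewrite e5 e3 e1 e4 e2.
exists (L2cst mu b) => /L2space_aeP ST0.
(* S T b = z |a|^2 |b|^4 a vanishes at no point, so it is nonzero in L^2
   because mu is. *)
have : {ae mu, forall z : borel (circle R), False}.
  apply: filter_app ST0; apply: filter_app (L2repr0 mu H).
  apply: filter_app (L2lift_ae (L2lift FT (L2cst mu b)) fFS).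
  apply: filter_app (L2lift_ae (L2cst mu b) fFT).
  apply: filterS (L2cst_ae mu b) => z e1 e2 e3 e4 e5.
  have : FS z (FT z b) = 0 by rewrite -[X in FT z X]e1 -e2 -e3 e5.
  rewrite ST /FS /FT /one !scale1r !linearZl_LR /= ab mulr0 scale0r scaler0 addr0 !sqn_inner.
  move/eqP; rewrite !scaler_eq0 !mulf_eq0 (negbTE (circle_val_neq0 z)).
  by rewrite !(inj_eq (@complexI R)) !sqn_eq0 (negbTE a0) (negbTE b0).
move=> [A [mA A0 TA]]; case/eqP: mu0; apply: (subset_measure0 _ mA _ A0) => //.
by move=> z _; apply: TA.
Qed.

End VectorTwist.

(** * The two statements *)

(* In (i), mu must not charge the point 1: for the Dirac mass at 1, U is the
   identity of a line and (S, T) = (U, U) is a U-commuting pair with ST <> 0. *)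
Theorem corollary3p4 (R : realType)
    (mu : {finite_measure set (borel (circle R)) -> \bar R})
    (mu_neq0 : mu [set: borel (circle R)] != 0%E) :
  (mu [set circle1 R] = 0%E ->
   forall (K : hilbertType R) (U : {linear K -> K}),
   unitary U -> unitarily_equivalent U (mulz mu (scalar_space R)) ->
   forall S T : {linear K -> K}, twisted_commuting U S T ->
   forall x : K, S (T x) = 0)
  /\
  (forall H : hilbertType R, dim_ge2 H ->
   forall (K : hilbertType R) (U : {linear K -> K}),
   unitary U -> unitarily_equivalent U (mulz mu H) ->
   exists S T : {linear K -> K},
     twisted_commuting U S T /\ exists x : K, S (T x) <> 0).
Proof.
split=> [mu1 K U _ [Q uQ QU] S T [Sb Tb US UT ST] x|H H2 K U _ [Q uQ QU]].
  have [S' [S'b QS]] := unitary_transport uQ (iffLR (bounded_operatorP S) Sb).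
  have [T' [T'b QT]] := unitary_transport uQ (iffLR (bounded_operatorP T) Tb).
  have Qsurj y : exists k, Q k = y by case: uQ => _; exact.
  have S'M y : S' (mulz mu _ y) = mulz mu _ (S' y).
    by have [k <-] := Qsurj y; rewrite -QU !QS -US QU.
  have T'M y : T' (mulz mu _ y) = mulz mu _ (T' y).
    by have [k <-] := Qsurj y; rewrite -QU !QT -UT QU.
  have QTS : Q (S (T x)) = Q (T (S x)).
    rewrite -(QS (T x)) -(QT x) (mulz_commutant_abelian S'b T'b S'M T'M).
    by rewrite (QS x) QT.
  apply: (unitary_inj uQ); rewrite linear0; apply: (mulz_fixed mu1).
  by rewrite {1}QTS -QU -ST.
have [S [T [[Sb Tb] MS MT ST [x STx]]]] := nontrivial_twist_model mu_neq0 H2.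
have [P uP PK] := unitary_inverse uQ.
have [S' [S'b PS]] := unitary_transport uP Sb.
have [T' [T'b PT]] := unitary_transport uP Tb.
have Psurj k : exists y, P y = k by case: uP => _; exact.
have UP y : U (P y) = P (mulz mu H y).
  by apply: (unitary_inj uQ); rewrite QU !PK.
exists S', T'; split; last first.
  exists (P x); rewrite PT PS => PSTx; apply: STx.
  by apply: (unitary_inj uP); rewrite PSTx linear0.
split; [exact/bounded_operatorP|exact/bounded_operatorP|..] => k;
  have [y <-] := Psurj k.
- by rewrite PS !UP PS MS.
- by rewrite PT !UP PT MT.
- by rewrite PT !PS PT UP ST.
Qed.
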